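(* Let $G = P_1 \times \cdots \times P_k$ be a finite nilpotent group (written as the direct product of its Sylow subgroups $P_1,\dots,P_k$) which is not a $2$-group. Then the difference graph $\mathcal{D}(G)$ is planar if and only if $G$ is isomorphic to one of the following groups: $$\mathbb{Z}_2 \times \mathbb{Z}_2 \times \mathbb{Z}_3, \qquad \mathbb{Z}_9 \times \mathbb{Z}_2, \qquad \mathbb{Z}_4 \times \mathbb{Z}_{p_2} \ \text{ with } p_2 \neq 2 \text{ a prime}.$$
   Context: All graphs are simple and undirected. Let $G$ be a finite group with identity $e$. The power graph $\mathcal{P}(G)$ has vertex set $G$, and two distinct vertices $x,y$ are adjacent if and only if $x \in \langle y\rangle$ or $y \in \langle x\rangle$. The intersection power graph $\mathcal{G}_1(G)$ has vertex set $G$; two distinct non-identity elements $x,y$ are adjacent if and only if $\langle x\rangle \cap \langle y\rangle \neq \{e\}$, and the identity $e$ is adjacent to all other elements. The difference graph $\mathcal{D}(G)$ is the difference of the intersection power graph and the power graph with all isolated vertices removed, that is, it is obtained from the graph with vertex set $G$ and edge set $E(\mathcal{G}_1(G)) \setminus E(\mathcal{P}(G))$ by removing all isolated vertices. A $2$-group is a finite group whose order is a power of $2$. $\mathbb{Z}_n$ denotes the cyclic group of order $n$. A graph is planar if it can be drawn in the plane with no two edges crossing.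
   Formalization: The difference graph D(G) is additionally assumed to have at least one vertex; when it is empty (for example G = Z_3 or Z_6) it is vacuously planar although G is not in the list, so the printed claim fails there. *)

(* Defs.v *)
From HB Require Import structures.
From mathcomp Require Import all_boot all_order all_algebra all_fingroup all_solvable.
From mathcomp Require Import all_classical all_reals all_analysis.
Import numFieldNormedType.Exports.
Set Implicit Arguments.
Unset Strict Implicit.
Unset Printing Implicit Defensive.
Import Order.TTheory GRing.Theory Num.Theory.
Local Open Scope ring_scope.

(** A simple graph whose vertices are elements of a finite type [T]. *)
Record sgraph (T : finType) := SGraph {
  verts : {set T};
  adj : rel T;
  adj_sym : symmetric adj;
  adj_irr : irreflexive adj;
  adj_verts : forall x y, adj x y -> x \in verts
}.

Definition edges (T : finType) (g : sgraph T) : {set {set T}} :=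
  [set E : {set T} | [exists x, exists y, adj g x y && (E == [set x; y]%SET)]]%SET.

Section GraphOperations.
Variable T : finType.
Implicit Types g h : sgraph T.

Fact graph_diff_sym g h : symmetric [rel x y | adj g x y && ~~ adj h x y].
Proof. by move=> x y /=; rewrite adj_sym [adj h x y]adj_sym. Qed.

Fact graph_diff_irr g h : irreflexive [rel x y | adj g x y && ~~ adj h x y].
Proof. by move=> x /=; rewrite adj_irr. Qed.

Fact graph_diff_verts g h x y :
  [rel x y | adj g x y && ~~ adj h x y] x y -> x \in verts g.
Proof. by case/andP=> /adj_verts. Qed.

Definition graph_diff g h : sgraph T :=
  SGraph (@graph_diff_sym g h) (@graph_diff_irr g h) (@graph_diff_verts g h).

Fact remove_isolated_verts g x y :
  adj g x y -> x \in [set x in verts g | [exists y, adj g x y]]%SET.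
Proof.
by move=> gxy; rewrite inE (adj_verts gxy); apply/existsP; exists y.
Qed.

Definition remove_isolated g : sgraph T :=
  SGraph (@adj_sym T g) (@adj_irr T g) (@remove_isolated_verts g).

End GraphOperations.

Section GroupGraphs.
Local Open Scope group_scope.
Variables (gT : finGroupType) (G : {group gT}).

Definition power_rel : rel gT := fun x y =>
  [&& x \in G, y \in G, x != y & (x \in <[y]>) || (y \in <[x]>)].

Fact power_rel_sym : symmetric power_rel.
Proof.
by move=> x y; rewrite /power_rel andbCA eq_sym orbC.
Qed.

Fact power_rel_irr : irreflexive power_rel.
Proof. by move=> x; rewrite /power_rel eqxx !andbF. Qed.

Fact power_rel_verts x y : power_rel x y -> x \in gval G.
Proof. by case/and4P. Qed.

Definition power_graph : sgraph gT :=
  SGraph power_rel_sym power_rel_irr power_rel_verts.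

Definition inter_power_rel : rel gT := fun x y =>
  [&& x \in G, y \in G, x != y
    & [|| x == 1, y == 1 | <[x]> :&: <[y]> != 1]].

Fact inter_power_rel_sym : symmetric inter_power_rel.
Proof.
by move=> x y; rewrite /inter_power_rel andbCA eq_sym orbCA finset.setIC.
Qed.

Fact inter_power_rel_irr : irreflexive inter_power_rel.
Proof. by move=> x; rewrite /inter_power_rel eqxx !andbF. Qed.

Fact inter_power_rel_verts x y : inter_power_rel x y -> x \in gval G.
Proof. by case/and4P. Qed.

Definition intersection_power_graph : sgraph gT :=
  SGraph inter_power_rel_sym inter_power_rel_irr inter_power_rel_verts.

Definition difference_graph : sgraph gT :=
  remove_isolated (graph_diff intersection_power_graph power_graph).

End GroupGraphs.

Local Open Scope classical_set_scope.

(** [arc E] parametrizes the edge [E] by the unit interval. An edge carries no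
    orientation, so its parametrization may start at either endpoint. *)
Record plane_drawing (R : realType) (T : finType) (g : sgraph T)
    (pos : T -> R * R) (arc : {set T} -> R -> R * R) : Prop := PlaneDrawing {
  pos_inj : {in verts g &, injective pos};
  arc_continuous : forall E, E \in edges g ->
    {within `[0, 1], continuous (arc E)};
  arc_inj : forall E, E \in edges g -> {in `[0, 1] &, injective (arc E)};
  arc_ends : forall x y, adj g x y ->
    (arc [set x; y]%SET 0 = pos x /\ arc [set x; y]%SET 1 = pos y) \/
    (arc [set x; y]%SET 0 = pos y /\ arc [set x; y]%SET 1 = pos x);
  arc_avoids_verts : forall E x t, E \in edges g -> x \in verts g ->
    t \in `]0, 1[ -> arc E t <> pos x;
  arc_no_crossing : forall E F s t, E \in edges g -> F \in edges g -> E != F ->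
    s \in `]0, 1[ -> t \in `]0, 1[ -> arc E s <> arc F t
}.

Definition planar (R : realType) (T : finType) (g : sgraph T) : Prop :=
  exists (pos : T -> R * R) (arc : {set T} -> R -> R * R),
    plane_drawing g pos arc.

(* Main.v *)
Require Import Defs.
From mathcomp Require Import all_boot all_order all_algebra all_fingroup all_solvable.
From mathcomp Require Import all_classical all_reals all_analysis.
From mathcomp Require Import lra ring zify.
Import numFieldNormedType.Exports.
Set Implicit Arguments.
Unset Strict Implicit.
Unset Printing Implicit Defensive.
Import Order.TTheory GRing.Theory Num.Theory.

(** Adjacency of [x] and [y] in the difference graph depends only on the cyclic
    groups they generate, so every edge spreads to a complete bipartite graph
    between the generators of [<[x]>] and those of [<[y]>].  Hence K_{3,3}, and
    no other obstruction, is what excludes the groups outside the list.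

    _K_{3,3} has no plane drawing_ ([K33_not_planar]).  For two disjoint arcs
    [E] and [F], the vector [E s - F t] never vanishes on the unit square, so
    its total rotation along the boundary of the square is zero.  Modulo 2 this
    relates, for each pair of independent edges, how often the four vectors
    joining an end of one edge to the other edge turn past the positive
    horizontal axis ([turns_square], [arcs_turns]).  Let [T i] be the parity of
    all the turns of the edges at [a i], each seen from the vertices [b l] it
    does not meet.  Adding the relations over the edges at two distinct vertices
    [a i] and [a j], everything cancels except [T i] and [T j] and the three
    signs of the pairs [b k], [b l], each of which is counted in both directions
    and contributes 1.  So [T i] and [T j] differ for all [i != j], which is
    absurd for three booleans ([K33_crossing]).

    _Planar cases._  In a cyclic group of order [p ^ 2 * q] the edges join
    elements of order [p ^ 2] to elements of order [p * q] ([cyclic_edge]).  In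
    the orders 18 and [4 * q] one of the two classes has two elements, and a
    graph whose edges all meet exactly one of two hubs is drawn with straight
    edges ([two_hubs_planar]).  For the group of order 12 the graph is an
    octahedron: its vertices are the six elements of order 6, and only an
    element and its inverse are not joined ([octahedron_planar]).

    _Excluding the other groups._  Totients are at most 2 only for the orders
    1, 2, 3, 4 and 6, and the ends of an edge have order neither 1 nor prime.  So
    in a planar difference graph one end of each edge has order 4 or 6
    ([edge_order_4_or_6]), all neighbours of a vertex of any other order
    generate the same cyclic group ([path_same_cycle]), and there is no 4-cycle
    through four different cyclic groups ([planar_square]).  Since a nilpotent
    group is the product of its 2-part and its odd part, elements [t * z] with
    prescribed parts supply enough edges for these three facts to force the
    order to be even, the odd part to be a [q]-group ([odd_part_pgroup]), and
    then the group itself, according to whether the odd part has an element of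
    order [q ^ 2] ([order9_odd_part]), else the 2-part has an element of order 4
    ([order4_two_part]), or both exponents are prime ([odd_part_prime],
    [two_part_klein], [cyclic_2q_no_edge]). *)

(** * Parity of the rotation of a discrete family of plane vectors *)

Section WindingParity.
Local Open Scope ring_scope.
Variable R : realType.
Implicit Types u v w : R * R.

(** The points of the open upper half-plane together with the positive horizontal
    axis: of two opposite nonzero vectors exactly one is upper. *)
Definition upper u := (0 < u.2) || (u.2 == 0) && (0 < u.1).

(** For nearby vectors away from the origin, whether the short step from [u] to
    [v] passes the positive horizontal axis; testing the side at [u] alone is
    enough, because the two vectors then lie on the same side. *)
Definition crossing u v := (upper u (+) upper v) && (0 < u.1).

(** Distance at least [d] from the origin in the maximum norm, with the maximum
    unfolded into its two linear cases. *)
Definition far (d : R) u := d <= `|u.1| \/ d <= `|u.2|.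

Definition nearby (d : R) u v := `|u.1 - v.1| < d /\ `|u.2 - v.2| < d.

Lemma far_neq0 d u : 0 < d -> far d u -> u != 0.
Proof.
move=> d0 fu; apply/eqP => u0; move: fu.
by rewrite u0 /far /= normr0; case; lra.
Qed.

Lemma upperN u : u != 0 -> upper (- u) = ~~ upper u.
Proof.
case: u => x y; rewrite xpair_eqE negb_and /upper /= !oppr_gt0 oppr_eq0.
by case: (ltgtP y 0) => //= _; case: (ltgtP x 0).
Qed.

Lemma nearbyC d u v : nearby d u v -> nearby d v u.
Proof. by case=> ? ?; split; rewrite distrC. Qed.

Lemma farC d u v : far d (u - v) -> far d (v - u).
Proof. by rewrite -(opprB v) /far /= !normrN. Qed.

(** Changing half-plane in a short step is possible only close to the horizontal
    axis, where a vector far from the origin has a large first coordinate. *)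
Lemma upper_switch d u v : far d u -> nearby d u v -> upper u != upper v ->
  d <= `|u.1|.
Proof.
case=> // du [_ uv].
suff -> : upper u = upper v by rewrite eqxx.
rewrite /upper; move: du uv; rewrite ler_normr ltr_norml => /orP[] ? /andP[? ?].
  have -> : 0 < u.2 by lra.
  by have -> : 0 < v.2 by lra.
have -> : (0 < u.2) = false by apply/negbTE; lra.
have -> : (0 < v.2) = false by apply/negbTE; lra.
have -> : (u.2 == 0) = false by apply/negbTE; lra.
by have -> : (v.2 == 0) = false by apply/negbTE; lra.
Qed.

Lemma same_side d u v : d <= `|u.1| -> nearby d u v -> (0 < v.1) = (0 < u.1).
Proof.
move=> du [+ _]; move: du.
rewrite ler_normr ltr_norml => /orP[] ? /andP[? ?]; apply/idP/idP; lra.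
Qed.

(** The cocycle relation: a small triangle away from the origin does not wind
    around it. *)
Lemma crossing_triangle d u v w :
  far d u -> far d v -> nearby d u v -> nearby d u w -> nearby d v w ->
  crossing u v (+) crossing v w = crossing u w.
Proof.
move=> fu fv uv uw vw; rewrite /crossing.
have [euv|/negPf nuv] := eqVneq (upper u) (upper v).
  rewrite euv addbb; case: (eqVneq (upper v) (upper w)) => [->|nvw].
    by rewrite addbb.
  by rewrite -(same_side (upper_switch fv vw nvw) (nearbyC uv)).
have du : d <= `|u.1| by apply: upper_switch fu uv _; rewrite nuv.
rewrite (same_side du uv); move: nuv.
by case: (upper u); case: (upper v); case: (upper w); case: (0 < u.1).
Qed.

(** Negation exchanges the two horizontal half-axes, and a step changes
    half-plane exactly when it passes one of them. *)
Lemma crossingN d u v : 0 < d -> far d u -> far d v -> nearby d u v ->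
  crossing (- u) (- v) = crossing u v (+) (upper u (+) upper v).
Proof.
move=> d0 fu fv uv; rewrite /crossing !upperN ?(far_neq0 d0) //= oppr_gt0.
case: (eqVneq (upper u) (upper v)) => [->|nuv]; first by rewrite !addbb.
have := upper_switch fu uv nuv; move: nuv.
by case: (upper u); case: (upper v) => //= _; case: (ltgtP u.1 0) => //= ->;
  rewrite normr0; lra.
Qed.

(** The parity of the number of turns past the positive horizontal axis of the
    direction from [v] to the [N] first steps of the polygon [E]. *)
Definition turns (N : nat) (v : R * R) (E : nat -> R * R) :=
  \big[addb/false]_(m < N) crossing (E m - v) (E m.+1 - v).

Lemma telescope_addb (N : nat) (f : nat -> bool) :
  \big[addb/false]_(m < N) (f m (+) f m.+1) = f 0%N (+) f N.
Proof.
elim: N => [|N IH]; first by rewrite big_ord0 addbb.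
by rewrite big_ord_recr /= IH addbA -(addbA (f 0%N)) addbb addbF.
Qed.

(** The vectors [E i - F j] form a grid whose cells do not wind around the
    origin, so neither does its boundary.  The sides on which [E] is fixed show
    [E - F] while [turns] is about [F - E]; the half-plane terms on the right
    are the price of these two negations. *)
Lemma turns_square (N : nat) (d : R) (E F : nat -> R * R) : 0 < d ->
  (forall i j, (i <= N)%N -> (j <= N)%N -> far d (E i - F j)) ->
  (forall i, (i < N)%N -> nearby (d / 2) (E i) (E i.+1)) ->
  (forall j, (j < N)%N -> nearby (d / 2) (F j) (F j.+1)) ->
  turns N (F 0%N) E (+) turns N (F N) E (+)
    (turns N (E 0%N) F (+) turns N (E N) F) =
  upper (F 0%N - E 0%N) (+) upper (F N - E 0%N) (+)
    (upper (F 0%N - E N) (+) upper (F N - E N)).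
Proof.
move=> d0 fEF cE cF.
(* Two steps of half the size stay within the full tolerance. *)
have cD i i' j j' : nearby (d / 2) (E i) (E i') -> nearby (d / 2) (F j) (F j') ->
  nearby d (E i - F j) (E i' - F j').
  by rewrite /nearby !ltr_norml /= => -[/andP[? ?] /andP[? ?]] [/andP[? ?] /andP[? ?]];
    split; apply/andP; split; lra.
have cI u : nearby (d / 2) u u by split; rewrite subrr normr0; lra.
pose h i j := crossing (E i - F j) (E i.+1 - F j).
pose v i j := crossing (E i - F j) (E i - F j.+1).
have cell i j : (i < N)%N -> (j < N)%N ->
    v i j (+) v i.+1 j = h i j (+) h i j.+1.
  move=> iN jN; have [iN' jN'] := (ltnW iN, ltnW jN).
  have e : h i j (+) v i.+1 j = v i j (+) h i j.+1.
    rewrite (@crossing_triangle d) ?(@crossing_triangle d) //;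
      do ?[exact: fEF | apply: cD => //; do ?[exact: cE | exact: cF]].
  by move: e; case: (h i j); case: (v i j); case: (v i.+1 j); case: (h i j.+1).
pose V i := \big[addb/false]_(j < N) v i j.
(* Adjacent columns differ by the top and bottom steps between them. *)
have colV : V 0%N (+) V N = turns N (F 0%N) E (+) turns N (F N) E.
  rewrite -(telescope_addb N V) /turns -big_split /=; apply: eq_bigr => i _.
  rewrite -big_split /= -[RHS](telescope_addb N (h i)); apply: eq_bigr => j _.
  exact: cell.
have turnV i : (i <= N)%N ->
    turns N (E i) F = V i (+) (upper (F 0%N - E i) (+) upper (F N - E i)).
  move=> iN.
  rewrite -(telescope_addb N (fun j => upper (F j - E i))) /turns -big_split /=.
  apply: eq_bigr => j _; have jN := ltn_ord j.
  have fN k : (k <= N)%N -> far d (F k - E i).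
    by move=> kN; apply/farC/fEF.
  have cN : nearby d (F j - E i) (F j.+1 - E i).
    have [? ?] := cF _ jN; split=> /=; rewrite opprB addrA subrK; lra.
  rewrite /v -(opprB (F j)) -(opprB (F j.+1)) (crossingN d0 (fN j (ltnW jN)) (fN _ jN) cN).
  by rewrite -addbA addbb addbF.
rewrite !turnV // -colV.
by case: (V 0%N); case: (V N); case: (upper _) => //=; case: (upper _) => //=;
  case: (upper _) => //=; case: (upper _).
Qed.

End WindingParity.

(** * Compactness of arcs *)

Section Arcs.
Local Open Scope ring_scope.
Variable R : realType.

Lemma far_perturb (d n : R) (u v u' v' : R * R) : far d (u - v) ->
  nearby (d / 4) u u' -> nearby (d / 4) v v' -> n < d / 4 -> far n (u' - v').
Proof.
rewrite /nearby !ltr_norml => fd [/andP[? ?] /andP[? ?]] [/andP[? ?] /andP[? ?]] ?.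
by case: fd; rewrite /far /= !ler_normr => /orP[]?; [left|left|right|right];
  apply/orP; [left|right|left|right]; lra.
Qed.

Implicit Types E F : R -> R * R.
Local Open Scope classical_set_scope.

Lemma continuous_nearby E (x e : R) : {within `[0, 1], continuous E} ->
  0 < e -> `[0, 1] x ->
  \forall y \near x, `[0, 1] y -> nearby e (E x) (E y).
Proof.
move=> /subspace_continuousP cE e0 x01.
have /cvg_ball /(_ _ e0) := cE x x01.
by rewrite near_withinE; apply: filterS => y h /h.
Qed.

Lemma arc_unif_continuous E (e : R) : {within `[0, 1], continuous E} -> 0 < e ->
  \forall N \near \oo, forall s t : R, `[0, 1] s -> `[0, 1] t ->
    `|s - t| <= N.+1%:R^-1 -> nearby e (E s) (E t).
Proof.
move=> cE e0.
have e20 : 0 < e / 2 by lra.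
pose P (N : nat) (s : R) := forall t, `[0, 1] s -> `[0, 1] t ->
    `|s - t| <= N.+1%:R^-1 -> nearby e (E s) (E t).
suff : \forall N \near \oo, `[0, 1] `<=` P N.
  by apply: filterS => N h s t s01; apply: h.
apply: (iffLR (compact_near_coveringP _) (@segment_compact R 0 1) nat).
move=> x x01.
have /nbhs_ballP[r /= r0 xr] := continuous_nearby cE e20 x01.
have r20 : 0 < r / 2 by lra.
near=> s N; rewrite /P /= => t s01 t01 st.
have /ltW sr : `|x - s| < r / 2.
  near: s; apply/nbhs_ballP; exists (r / 2) => //.
have tr : N.+1%:R^-1 < r / 2.
  by near: N; exact: (near_infty_natSinv_lt (PosNum r20)).
have [] : nearby (e / 2) (E x) (E s).
  by apply: xr => //; rewrite /= -ball_normE /=; lra.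
have [] : nearby (e / 2) (E x) (E t).
  apply: xr => //; rewrite /= -ball_normE /=.
  apply: le_lt_trans (ler_distD s x t) _.
  by rewrite (splitr r) ler_ltD // (le_lt_trans st).
rewrite /nearby !ltr_norml => /andP[? ?] /andP[? ?] /andP[? ?] /andP[? ?].
by split; apply/andP; split; lra.
Unshelve. all: by end_near. Qed.

(** Compactness of the product of the two parameter intervals. *)
Lemma arcs_far E F :
  {within `[0, 1], continuous E} -> {within `[0, 1], continuous F} ->
  (forall s t, `[0, 1] s -> `[0, 1] t -> E s <> F t) ->
  exists2 d : R, 0 < d & forall s t, `[0, 1] s -> `[0, 1] t -> far d (E s - F t).
Proof.
move=> cE cF EF.
pose P (N : nat) (p : R * R) := `[0, 1] p.1 -> `[0, 1] p.2 ->
  far N.+1%:R^-1 (E p.1 - F p.2).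
have : \forall N \near \oo, `[0, 1] `*` `[0, 1] `<=` P N.
  apply: (iffLR (compact_near_coveringP _)
    (compact_setX (@segment_compact R 0 1) (@segment_compact R 0 1)) nat).
  move=> [x y] [/= x01 y01].
  have [d d0 fd] : exists2 d : R, 0 < d & far d (E x - F y).
    have : ((E x).1 - (F y).1 != 0) || ((E x).2 - (F y).2 != 0).
      rewrite !subr_eq0 -negb_and; apply/negP => /andP[/eqP e1 /eqP e2].
      by apply: (EF x y x01 y01); move: e1 e2; case: (E x) (F y) => a b [c d] /= -> ->.
    rewrite -!normr_gt0 => /orP[]?.
      by exists (`|(E x).1 - (F y).1|) => //; left.
    by exists (`|(E x).2 - (F y).2|) => //; right.
  have d40 : 0 < d / 4 by lra.
  have hx := continuous_nearby cE d40 x01.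
  have hy := continuous_nearby cF d40 y01.
  have hN := near_infty_natSinv_lt (PosNum d40).
  have hp : \forall p \near ((x, y) : R * R),
     (`[0, 1] p.1 -> nearby (d / 4) (E x) (E p.1)) /\
     (`[0, 1] p.2 -> nearby (d / 4) (F y) (F p.2)).
    by exists ([set s | `[0, 1] s -> nearby (d / 4) (E x) (E s)],
       [set s | `[0, 1] s -> nearby (d / 4) (F y) (F s)]).
  near=> p N; rewrite /P /= => p1 p2.
  have [/(_ p1)[+ +] /(_ p2)[+ +]] : (`[0, 1] p.1 -> nearby (d / 4) (E x) (E p.1)) /\
     (`[0, 1] p.2 -> nearby (d / 4) (F y) (F p.2)) by near: p.
  have lN : N.+1%:R^-1 < d / 4 by near: N.
  by move=> e2 e1 f2 f1; apply: (far_perturb fd) lN.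
move=> [N _ /(_ N) h]; exists N.+1%:R^-1; first by rewrite invr_gt0.
by move=> s t s01 t01; apply: (h _ (s, t)) => //=.
Unshelve. all: by end_near. Qed.

End Arcs.

(** * The complete bipartite graph K_{3,3} cannot be drawn *)

Section K33.
Local Open Scope ring_scope.
Variable R : realType.
Local Open Scope classical_set_scope.

Definition sample (E : R -> R * R) (N m : nat) : R * R := E (m%:R / N%:R).

Lemma sample_itv (N m : nat) : (0 < N)%N -> (m <= N)%N -> `[0, 1] (m%:R / N%:R : R).
Proof.
move=> N0 mN; rewrite /= in_itv /= divr_ge0 //=.
by rewrite ler_pdivrMr ?ltr0n // mul1r ler_nat.
Qed.

Lemma sample_nearby (E : R -> R * R) (e : R) :
  {within `[0, 1], continuous E} -> 0 < e ->
  \forall N \near \oo, forall m, (m < N.+1)%N ->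
    nearby e (sample E N.+1 m) (sample E N.+1 m.+1).
Proof.
move=> cE e0; apply: filterS (arc_unif_continuous cE e0) => N h m mN.
apply: h; do ?by apply: sample_itv => //; exact: ltnW.
by rewrite -mulrBl -natr1 opprD addrA subrr sub0r mulN1r normrN gtr0_norm ?invr_gt0.
Qed.

Lemma sample_ends (E : R -> R * R) (N : nat) : (0 < N)%N ->
  sample E N 0 = E 0 /\ sample E N N = E 1.
Proof. by move=> N0; rewrite /sample mul0r divff // pnatr_eq0 -lt0n. Qed.

(** The relation is symmetric in the two ends of either arc, which absorbs the
    arbitrary orientation of a drawn edge. *)
Lemma arcs_turns (E F : R -> R * R) :
  {within `[0, 1], continuous E} -> {within `[0, 1], continuous F} ->
  (forall s t, `[0, 1] s -> `[0, 1] t -> E s <> F t) ->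
  \forall N \near \oo,
    turns N.+1 (F 0) (sample E N.+1) (+) turns N.+1 (F 1) (sample E N.+1) (+)
    (turns N.+1 (E 0) (sample F N.+1) (+) turns N.+1 (E 1) (sample F N.+1)) =
    upper (F 0 - E 0) (+) upper (F 1 - E 0) (+)
    (upper (F 0 - E 1) (+) upper (F 1 - E 1)).
Proof.
move=> cE cF EF; have [d d0 fEF] := arcs_far cE cF EF.
have d20 : 0 < d / 2 by lra.
near=> N.
have [e0 e1] := @sample_ends E N.+1 isT; have [f0 f1] := @sample_ends F N.+1 isT.
rewrite -e0 -e1 -f0 -f1; apply: (turns_square d0).
- by move=> i j iN jN; apply: fEF; apply: sample_itv.
- by near: N; exact: sample_nearby.
- by near: N; exact: sample_nearby.
Unshelve. all: by end_near. Qed.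

(** The sum modulo 2 over the ordered pairs of distinct indices. *)
Definition off_diagonal (f : 'I_3 -> 'I_3 -> bool) :=
  (f 0 1 (+) f 1 0) (+) (f 0 2 (+) f 2 0) (+) (f 1 2 (+) f 2 1).

Lemma off_diagonalD f g : off_diagonal (fun k l => f k l (+) g k l) =
  off_diagonal f (+) off_diagonal g.
Proof.
rewrite /off_diagonal (addbACA (f 0 1)) (addbACA (f 0 2)) (addbACA (f 1 2)).
by rewrite (addbACA (f 0 1 (+) _)) addbACA.
Qed.

Lemma off_diagonal_tr f : off_diagonal (fun k l => f l k) = off_diagonal f.
Proof. by rewrite /off_diagonal ![f 1 0 (+) _]addbC ![f 2 _ (+) _]addbC. Qed.

(** Each index occurs twice on each side. *)
Lemma off_diagonal_sep (f g : 'I_3 -> bool) :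
  off_diagonal (fun k l => f k (+) g l) = false.
Proof.
by rewrite /off_diagonal; case: (f 0); case: (f 1); case: (f 2);
  case: (g 0); case: (g 1); case: (g 2).
Qed.

(** There are three unordered pairs, and three is odd. *)
Lemma off_diagonal_anti (h : 'I_3 -> 'I_3 -> bool) :
  (forall k l, k != l -> h l k = ~~ h k l) -> off_diagonal h = true.
Proof.
move=> hN; rewrite /off_diagonal (hN 0 1) // (hN 0 2) // (hN 1 2) //.
by case: (h 0 1); case: (h 0 2); case: (h 1 2).
Qed.

Lemma eq_off_diagonal f g : (forall k l, k != l -> f k l = g k l) ->
  off_diagonal f = off_diagonal g.
Proof. by move=> fg; rewrite /off_diagonal !fg. Qed.

(** The parity argument.  Two independent edges [E i k] and [E j l] satisfy the
    relation of [arcs_turns]; summing it over [k != l] for fixed [i != j] shows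
    that [T i] and [T j] are different booleans. *)
Lemma K33_crossing (a b : 'I_3 -> R * R) (E : 'I_3 -> 'I_3 -> R -> R * R) :
  (forall i k, {within `[0, 1], continuous (E i k)}) ->
  (forall i k, (E i k 0 = a i /\ E i k 1 = b k) \/
               (E i k 0 = b k /\ E i k 1 = a i)) ->
  (forall i j k l s t, i != j -> k != l -> `[0, 1] s -> `[0, 1] t ->
     E i k s <> E j l t) -> False.
Proof.
move=> cE endE disE.
have I0 : `[0, 1] (0 : R) by rewrite /= in_itv /= lexx ler01.
have I1 : `[0, 1] (1 : R) by rewrite /= in_itv /= lexx ler01.
pose turn N v i k := turns N.+1 v (sample (E i k) N.+1).
have square i j k l : \forall N \near \oo, i != j -> k != l ->
    turn N (b l) i k (+) turn N (b k) j l =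
    (turn N (a j) i k (+) upper (a j - b k) (+) upper (a j - a i)) (+)
    (turn N (a i) j l (+) upper (b l - a i)) (+) upper (b l - b k).
  have [ij|_] := boolP (i != j); last exact: nearW.
  have [kl|_] := boolP (k != l); last exact: nearW.
  have := arcs_turns (cE i k) (cE j l) (fun s t => disE i j k l s t ij kl).
  apply: filterS => N eqN _ _; move: eqN; rewrite -/(turn _ _ _ _) /turn.
  have [[-> ->]|[-> ->]] := endE i k; have [[-> ->]|[-> ->]] := endE j l;
  by do !(case: turns => /=); do !(case: upper => /=).
have {square} square : \forall N \near \oo, forall i j k l, i != j -> k != l ->
    turn N (b l) i k (+) turn N (b k) j l =
    (turn N (a j) i k (+) upper (a j - b k) (+) upper (a j - a i)) (+)
    (turn N (a i) j l (+) upper (b l - a i)) (+) upper (b l - b k).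
  by do 4!apply: filter_forall => ?.
have [N eqN] := filter_ex square.
(* Each [b k] lies on some edge, and these edges can be taken independent. *)
have bN k l : k != l -> upper (b k - b l) = ~~ upper (b l - b k).
  move=> kl; rewrite -opprB upperN // subr_eq0; apply/eqP => blk.
  have [] : [/\ exists2 s, `[0, 1] s & E 0 k s = b k
              & exists2 t, `[0, 1] t & E 1 l t = b l].
    by split; [case: (endE 0 k)|case: (endE 1 l)] => -[? ?];
      [exists 1|exists 0|exists 1|exists 0].
  by move=> [s s01 es] [t t01 et]; apply: (disE 0 1 k l s t) => //; rewrite es et.
(* How often the edges at [a i] turn past the axis, each edge seen from the
   vertices [b l] other than its own end. *)
pose T i := off_diagonal (fun k l => turn N (b l) i k).
have TN i j : i != j -> T i != T j.
  move=> ij; suff : T i (+) T j = true by case: (T i); case: (T j).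
  rewrite /T -[X in _ (+) X]off_diagonal_tr -off_diagonalD.
  rewrite (eq_off_diagonal (fun k l kl => eqN i j k l ij kl)) off_diagonalD.
  by rewrite off_diagonal_sep (off_diagonal_anti bN).
by have := (TN 0 1 isT, TN 0 2 isT, TN 1 2 isT); case: (T 0); case: (T 1); case: (T 2) => -[[]].
Qed.

End K33.

(** * Drawings of graphs *)

Section GraphDrawings.
Local Open Scope ring_scope.
Variables (R : realType) (T : finType) (g : sgraph T).
Local Open Scope classical_set_scope.

Lemma mem_edges x y : adj g x y -> [set x; y]%SET \in edges g.
Proof.
move=> gxy; rewrite inE; apply/existsP; exists x; apply/existsP; exists y.
by rewrite gxy eqxx.
Qed.

Lemma itv01_cases (t : R) : `[0, 1] t -> [\/ t = 0, t = 1 | t \in `]0, 1[%R].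
Proof.
rewrite /= !in_itv /= => /andP[].
rewrite !le_eqVlt => /orP[/eqP<-|t0]; first by constructor 1.
by case/orP => [/eqP->|t1]; [constructor 2|constructor 3; rewrite t0 t1].
Qed.

Lemma adj_vertices x y : adj g x y -> x \in verts g /\ y \in verts g.
Proof.
by move=> gxy; split; apply: adj_verts; [exact: gxy|rewrite adj_sym; exact: gxy].
Qed.

(** A drawing separates edges without a common vertex up to and including their
    ends. *)
Lemma disjoint_edges_arcs pos arc : plane_drawing g pos arc ->
  forall (x y z w : T) (s t : R), adj g x y -> adj g z w ->
  x != z -> x != w -> y != z -> y != w -> `[0, 1] s -> `[0, 1] t ->
  arc [set x; y]%SET s <> arc [set z; w]%SET t.
Proof.
move=> [posI _ _ ends avoid cross] x y z w s t gxy gzw xz xw yz yw.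
have [vx vy] := adj_vertices gxy; have [vz vw] := adj_vertices gzw.
have [exy ezw] := (mem_edges gxy, mem_edges gzw).
have neE : [set x; y]%SET != [set z; w]%SET.
  by apply/eqP => /setP/(_ x); rewrite !inE eqxx (negPf xz) (negPf xw).
have end_pos (u v : T) r : adj g u v -> `[0, 1] r ->
    [\/ arc [set u; v]%SET r = pos u, arc [set u; v]%SET r = pos v | r \in `]0, 1[%R].
  move=> guv /itv01_cases[->|->|?]; last by constructor 3.
    by case: (ends _ _ guv) => -[-> _]; [constructor 1|constructor 2].
  by case: (ends _ _ guv) => -[_ ->]; [constructor 2|constructor 1].
have posN u v : u \in verts g -> v \in verts g -> u != v -> pos u <> pos v.
  by move=> vu vv /eqP uv /posI e; apply/uv/e.
move=> s01 t01.
case: (end_pos _ _ _ gxy s01) => [->|->|si]; case: (end_pos _ _ _ gzw t01) => [->|->|ti];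
  try exact: posN.
- exact/nesym/avoid/mem_set.
- exact/nesym/avoid/mem_set.
- exact/avoid/mem_set.
- exact/avoid/mem_set.
by apply: cross => //; exact: mem_set.
Qed.

Lemma K33_not_planar (A B : {set T}) : (2 < #|A|)%N -> (2 < #|B|)%N ->
  (forall x y, x \in A -> y \in B -> adj g x y) -> ~ planar R g.
Proof.
move=> A3 B3 gAB [pos [arc dr]].
have emb (C : {set T}) : (2 < #|C|)%N ->
    {f : 'I_3 -> T | injective f & forall i, f i \in C}.
  move=> C3; exists (fun i => enum_val (widen_ord C3 i)) => [i j /enum_val_inj|i].
    by move/(congr1 val) => /= ij; apply: val_inj.
  exact: enum_valP.
have [a aI aA] := emb A A3; have [b bI bB] := emb B B3.
have gab i k : adj g (a i) (b k) by apply: gAB.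
have neab i k : a i != b k by apply: contraTneq (gab i k) => ->; rewrite adj_irr.
have [posI cont _ ends _ _] := dr.
apply: (@K33_crossing R (pos \o a) (pos \o b) (fun i k => arc [set a i; b k]%SET)).
- by move=> i k; apply: cont; apply: mem_edges.
- by move=> i k; apply: ends.
move=> i j k l s t ij kl; apply: (disjoint_edges_arcs dr) => //.
- by apply: contra_neq ij => /aI.
- by rewrite eq_sym.
by apply: contra_neq kl => /bI.
Qed.

Definition segment (p q : R * R) (t : R) : R * R :=
  (p.1 + t * (q.1 - p.1), p.2 + t * (q.2 - p.2)).

Lemma segment_continuous (p q : R * R) : continuous (segment p q).
Proof.
have line (a b : R) : continuous (fun t : R => a + t * b).
  move=> t; apply: cvgD; first exact: cvg_cst.
  by apply: cvgM; [exact: cvg_id|exact: cvg_cst].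
move=> t; exact: (cvg_pair (line _ _ t) (line _ _ t)).
Qed.

(** An edge has no orientation, so its segment is run from whichever ordered pair
    the choice operator returns. *)
Lemma straight_drawing (pos : T -> R * R) :
  {in verts g &, injective pos} ->
  (forall x y z t, adj g x y -> z \in verts g -> t \in `]0, 1[%R ->
     segment (pos x) (pos y) t <> pos z) ->
  (forall x y z w s t, adj g x y -> adj g z w ->
     s \in `]0, 1[%R -> t \in `]0, 1[%R ->
     segment (pos x) (pos y) s = segment (pos z) (pos w) t ->
     [set x; y]%SET = [set z; w]%SET) ->
  planar R g.
Proof.
move=> posI avoid cross.
pose arc (e : {set T}) :=
  if [pick p : T * T | adj g p.1 p.2 && (e == [set p.1; p.2]%SET)] is Some p
  then segment (pos p.1) (pos p.2) else fun=> (0, 0).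
have arcP e : e \in edges g -> exists x y,
    [/\ adj g x y, e = [set x; y]%SET & arc e = segment (pos x) (pos y)].
  rewrite inE => /existsP[x /existsP[y exy]]; rewrite /arc.
  case: pickP => [[u v] /= /andP[guv /eqP ->]|/(_ (x, y))]; last by rewrite /= exy.
  by exists u, v.
exists pos, arc; split => //.
- move=> e /arcP[x [y [_ _ ->]]]; apply: continuous_subspaceT => t.
  exact: segment_continuous.
- move=> e /arcP[x [y [gxy _ ->]]] s t _ _ [/addrI e1 /addrI e2].
  have [xv yv] := adj_vertices gxy.
  have [q1|/mulIf] := eqVneq ((pos y).1 - (pos x).1) 0; last exact.
  have [q2|/mulIf] := eqVneq ((pos y).2 - (pos x).2) 0; last exact.
  suff xy : x = y by move: gxy; rewrite xy adj_irr.
  apply: posI => //; move/eqP: q1; move/eqP: q2; rewrite !subr_eq0 => /eqP + /eqP.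
  by case: (pos x) (pos y) => ? ? [? ?] /= -> ->.
- move=> x y /mem_edges /arcP[u [v [guv xy ->]]].
  have -> : segment (pos u) (pos v) 0 = pos u.
    by rewrite /segment !mul0r !addr0; case: (pos u).
  have -> : segment (pos u) (pos v) 1 = pos v.
    by rewrite /segment; case: (pos u) (pos v) => ? ? [? ?] /=; congr (_, _); ring.
  have : u \in [set x; y]%SET by rewrite xy !inE eqxx.
  have : v \in [set x; y]%SET by rewrite xy !inE eqxx orbT.
  rewrite !inE => /orP[]/eqP ev /orP[]/eqP eu; subst u v;
    by [left | right | rewrite adj_irr in guv].
- by move=> e x t /arcP[u [v [guv _ ->]]] vx /set_mem t01; apply: avoid.
move=> e f s t /arcP[x [y [gxy -> ->]]] /arcP[z [w [gzw -> ->]]] /eqP ef.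
move=> /set_mem s01 /set_mem t01 est.
by apply: ef; apply: cross est.
Qed.

End GraphDrawings.

(** * Two families of planar graphs *)

Section Families.
Local Open Scope ring_scope.
Variables (R : realType) (T : finType) (g : sgraph T).

Lemma segmentC (p q : R * R) t : segment p q t = segment q p (1 - t).
Proof. by rewrite /segment; congr (_, _); ring. Qed.

Lemma itv01_sub (t : R) : t \in `]0, 1[%R -> 1 - t \in `]0, 1[%R.
Proof. by rewrite !in_itv /= => /andP[? ?]; apply/andP; split; lra. Qed.

(** The hubs are placed at heights 1 and -1 on the vertical axis and the other
    vertices on the positive horizontal axis.  A point inside an edge has
    nonzero height, whose sign gives the hub and whose value gives the position
    along the edge; its abscissa then gives the other end. *)
Lemma two_hubs_planar (A : {set T}) : (#|A| <= 2)%N ->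
  (forall x y, adj g x y -> (x \in A) != (y \in A)) -> planar R g.
Proof.
move=> A2 gA.
(* The index in the enumeration is 0 or 1, so the height is 1 or -1. *)
pose hub x : R := 1 - 2 * (index x (enum A))%:R.
pose rim (x : T) : R := (enum_rank x).+1%:R.
pose pos x := if x \in A then (0, hub x) else (rim x, 0).
have rim_gt0 x : 0 < rim x by rewrite ltr0n.
have rimI : injective rim.
  by move=> x y /eqP; rewrite eqr_nat eqSS => /eqP/ord_inj/enum_rank_inj.
have indexA x : x \in A -> (index x (enum A) < 2)%N.
  by move=> xA; apply: leq_trans A2; rewrite cardE index_mem mem_enum.
have hubI x y : x \in A -> y \in A -> 0 < hub x * hub y -> x = y.
  move=> xA yA hxy; have [xE yE] : x \in enum A /\ y \in enum A by rewrite !mem_enum.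
  apply: (index_inj x xE yE); move: hxy (indexA _ xA) (indexA _ yA); rewrite /hub.
  by case: (index x _) => [|[|]] //; case: (index y _) => [|[|]] // h; exfalso; lra.
have hub2 x : x \in A -> hub x = 1 \/ hub x = -1.
  move/indexA; rewrite /hub; case: (index x _) => [|[|]] // _; [left|right]; lra.
have seg x y t : adj g x y -> t \in `]0, 1[%R -> exists a b r,
    [/\ a \in A, b \notin A & [set x; y]%SET = [set a; b]%SET] /\
    [/\ 0 < r, r < 1 & segment (pos x) (pos y) t = (rim b * r, hub a * (1 - r))].
  wlog xA : x y t / x \in A => [th|] gxy t01.
    have := gA _ _ gxy; have [xA _|xA /= yA] := boolP (x \in A); first exact: th.
    have {}yA : y \in A by apply: contraNT xA; move: yA; case: (y \in A).
    rewrite segmentC finset.setUC; apply: th => //; first by rewrite adj_sym.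
    exact: itv01_sub.
  have yA : y \notin A by have := gA _ _ gxy; rewrite xA; case: (y \in A).
  exists x, y, t; split; split=> //; move: t01; rewrite in_itv /= => /andP[] //.
  by move=> _ _; rewrite /pos xA (negPf yA) /segment /=; congr (_, _); ring.
apply: (straight_drawing (pos := pos)).
- move=> x y _ _; rewrite /pos; case: ifP => xA; case: ifP => yA => -[].
  + move=> e; apply: hubI => //; rewrite e.
    by case: (hub2 y yA) => ->; lra.
  + by move=> e; have := rim_gt0 y; rewrite -e ltxx.
  + by move=> e; have := rim_gt0 x; rewrite e ltxx.
  by move/rimI.
- move=> x y z t gxy _ t01; have [a [b [r [[aA bA _] [r0 r1 ->]]]]] := seg _ _ _ gxy t01.
  rewrite /pos; case: ifP => _ [].
    by move/eqP; rewrite mulf_eq0 !gt_eqF.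
  move=> _ /eqP; rewrite mulf_eq0 [1 - r == 0]subr_eq0 (gt_eqF r1) orbF.
  by case: (hub2 a aA) => -> /eqP; lra.
move=> x y z w s t gxy gzw s01 t01.
have [a [b [r [[aA bA ->] [r0 r1 ->]]]]] := seg _ _ _ gxy s01.
have [c [d [q [[cA dA ->] [q0 q1 ->]]]]] := seg _ _ _ gzw t01.
move=> [e1 e2].
have ac : a = c.
  apply: hubI => //; case: (hub2 a aA) e2 => ->; case: (hub2 c cA) => ->; lra.
have rq : r = q.
  by move: e2; rewrite ac; case: (hub2 c cA) => ->; lra.
suff -> : b = d by rewrite ac.
by apply: rimI; move: e1; rewrite rq => /mulIf; apply; rewrite gt_eqF.
Qed.

(** A small triangle inside a large one; opposite vertices of the octahedron
    share the index [i], and the small triangle has the vertex [i] next to the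
    side of the large triangle that misses the vertex [i]. *)
Definition octahedron_pos (i : nat) (outer : bool) : R * R :=
  match i, outer with
  | 0%N, true => (0, 6) | 1%N, true => (-6, -6) | _, true => (6, -6)
  | 0%N, false => (0, -3) | 1%N, false => (2, 0) | _, false => (-2, 0)
  end.

Lemma octahedron_posI i b j c : octahedron_pos i b = octahedron_pos j c ->
  (i < 3)%N -> (j < 3)%N -> i = j /\ b = c.
Proof.
case: i => [|[|[|i]]] e //; case: j e => [|[|[|j]]] e // _ _;
  by case: b e; case: c => e; split => //; exfalso; case: e => *; lra.
Qed.

Lemma octahedron_avoid i b j c k d t : (i < j < 3)%N -> (k < 3)%N ->
  0 < t < 1 ->
  segment (octahedron_pos i b) (octahedron_pos j c) t <> octahedron_pos k d.
Proof.
move=> /andP[ij j3] k3 /andP[? ?].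
case: i ij => [|[|i]] ij; case: j ij j3 => [|[|[|j]]] // _ _;
  case: k k3 => [|[|[|k]]] // _;
  case: b; case: c; case: d; rewrite /segment /= => -[]; lra.
Qed.

Lemma octahedron_cross i b j c k d l e s t : (i < j < 3)%N -> (k < l < 3)%N ->
  0 < s < 1 -> 0 < t < 1 ->
  segment (octahedron_pos i b) (octahedron_pos j c) s =
  segment (octahedron_pos k d) (octahedron_pos l e) t ->
  [/\ i = k, b = d, j = l & c = e].
Proof.
move=> /andP[ij j3] /andP[kl l3] /andP[? ?] /andP[? ?].
case: i ij => [|[|i]] ij; case: j ij j3 => [|[|[|j]]] // _ _;
  case: k kl => [|[|k]] kl; case: l kl l3 => [|[|[|l]]] // _ _;
  case: b; case: c; case: d; case: e; rewrite /segment /= => -[] ? ?;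
  do ?[by split]; exfalso; lra.
Qed.

(** Opposite vertices carry the same class, so edges only join different
    classes. *)
Lemma octahedron_planar (cls : T -> nat) (side : T -> bool) :
  {in verts g, forall x, (cls x < 3)%N} ->
  {in verts g &, forall x y, cls x = cls y -> side x = side y -> x = y} ->
  (forall x y, adj g x y -> cls x != cls y) -> planar R g.
Proof.
move=> cls3 clsI gcls; pose pos x := octahedron_pos (cls x) (side x).
have sorted x y t : adj g x y -> t \in `]0, 1[%R -> exists a b r,
    [/\ a \in verts g, b \in verts g & [set x; y]%SET = [set a; b]%SET] /\
    [/\ (cls a < cls b < 3)%N, 0 < r < 1 &
        segment (pos x) (pos y) t = segment (pos a) (pos b) r].
  move=> gxy t01; have [xv yv] := adj_vertices gxy.
  have := gcls _ _ gxy; rewrite neq_ltn => /orP[xy|yx].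
    by exists x, y, t; split; split => //; rewrite xy cls3.
  exists y, x, (1 - t); split; split => //; first by rewrite finset.setUC.
  - by rewrite yx cls3.
  - exact: itv01_sub t01.
  exact: segmentC.
apply: (straight_drawing (pos := pos)).
- move=> x y xv yv /octahedron_posI[] //; [exact: cls3|exact: cls3|exact: clsI].
- move=> x y z t gxy zv t01 e.
  have [a [b [r [_ [ab r01 er]]]]] := sorted _ _ _ gxy t01.
  exact: (octahedron_avoid ab (cls3 _ zv) r01 (etrans (esym er) e)).
move=> x y z w s t gxy gzw s01 t01 e.
have [a [b [r [[av bv ->] [ab r01 er]]]]] := sorted _ _ _ gxy s01.
have [c [d [q [[cv dv ->] [cd q01 eq]]]]] := sorted _ _ _ gzw t01.
have [] := octahedron_cross ab cd r01 q01 (etrans (esym er) (etrans e eq)).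
by move=> /(clsI _ _ av cv) ac /ac-> /(clsI _ _ bv dv) bd /bd->.
Qed.

End Families.

(** * Edges of the difference graph *)

(** A prime power [p ^ k] exactly dividing [n] contributes a factor
    [p.-1 * p ^ k.-1] to the totient, so [n] divides 12. *)
Lemma totient_le2 n : (0 < n)%N -> (totient n <= 2)%N ->
  n \in [:: 1; 2; 3; 4; 6]%N.
Proof.
move=> n0 phi_n.
have part p : prime p -> (p.-1 * p ^ (logn p n).-1 <= 2)%N || (p \notin primes n).
  move=> pp; rewrite orbC; case: (boolP (p \in primes n)) => //= pn.
  have ln : (0 < logn p n)%N by rewrite logn_gt0.
  have e : totient n = (totient n`_p * totient n`_p^')%N.
    by rewrite -totient_coprime ?coprime_partC // partnC.
  apply: leq_trans phi_n; rewrite e p_part totient_pfactor //.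
  by rewrite leq_pmulr // totient_gt0 part_gt0.
have : (n %| 12)%N.
  apply/dvdn_partP => // p; rewrite mem_primes => /and3P[pp _ pn].
  have := part p pp; rewrite mem_primes pp n0 pn /= orbF => le2.
  have ln : (0 < logn p n)%N by rewrite logn_gt0 mem_primes pp n0.
  rewrite p_part; have p3 : (p <= 3)%N.
    rewrite leqNgt; apply/negP => p4; move: le2; rewrite leqNgt => /negP; apply.
    apply: leq_trans (leq_pmulr _ _); last by rewrite expn_gt0 prime_gt0.
    by rewrite -ltnS prednK // prime_gt0.
  case: p p3 pp pn le2 ln => [|[|[|[|p]]]] // _ _ _; move: (logn _ n) => [|[|[|k]]] //=;
    rewrite ?expnS; have := expn_gt0 2 k; have := expn_gt0 3 k => /=; lia.
by move=> {part} /dvdn_leq -/(_ isT); move: n0 phi_n; do 13!(case: n => [|n] //).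
Qed.

Section DifferenceGraph.
Local Open Scope group_scope.
Variables (gT : finGroupType) (G : {group gT}).
Notation D := (difference_graph G).
Implicit Types x y : gT.

Lemma dadjE x y : adj D x y =
  [&& x \in G, y \in G, <[x]> :&: <[y]> != 1, x \notin <[y]> & y \notin <[x]> ].
Proof.
rewrite /= /inter_power_rel /power_rel; case: (x \in G) => //=.
case: (y \in G) => //=; have [->|_] /= := eqVneq x y; first by rewrite cycle_id andbF.
have [->|x1] /= := eqVneq x 1; first by rewrite group1 andbF.
have [->|y1] /= := eqVneq y 1; first by rewrite group1 orbT !andbF.
by rewrite negb_or.
Qed.

Lemma dadjI c x y : x \in G -> y \in G -> c != 1 -> c \in <[x]> -> c \in <[y]> ->
  x \notin <[y]> -> y \notin <[x]> -> adj D x y.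
Proof.
move=> xG yG c1 cx cy xy yx; rewrite dadjE xG yG xy yx !andbT /=.
by apply: contraNneq c1 => I1; apply/eqP/set1gP; rewrite -I1 inE cx.
Qed.

(** Every condition in [dadjE] is one on the cyclic groups generated by the two
    elements. *)
Lemma dadj_cycle x y x' y' : <[x']> = <[x]> -> <[y']> = <[y]> ->
  adj D x y -> adj D x' y'.
Proof. by move=> ex ey; rewrite !dadjE -!cycle_subG /= ex ey. Qed.

(** A cyclic group of prime order meeting [<[y]>] lies inside it. *)
Lemma dadj_order x y : adj D x y -> (2 < #[x])%N /\ ~~ prime #[x].
Proof.
rewrite dadjE => /and5P[_ _ I1 xy yx].
have npr : ~~ prime #[x].
  apply: contra xy => pr; rewrite -cycle_subG.
  by apply: contraR I1 => nsub; rewrite prime_TIg.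
split => //; case: (ltnP 2 #[x]) npr => //;
  case: #[x] (order_gt0 x) (order_eq1 x) => [|[|[|]]] //= _.
by move=> /esym/eqP x1; move: xy; rewrite x1 group1.
Qed.

Definition gens x : {set gT} := [set y | generator <[x]> y].

Lemma card_gensU x x' : <[x]> != <[x']> ->
  #|gens x :|: gens x'| = (totient #[x] + totient #[x'])%N.
Proof.
move=> xx'; rewrite !totient_gen -cardsUI -[LHS]addn0; congr (_ + _)%N.
apply/esym/eqP; rewrite cards_eq0; apply/eqP/setP => y.
by rewrite !inE /generator; apply/negbTE; apply: contra xx' => /andP[/eqP-> /eqP->].
Qed.

Lemma dadj_totient x y : adj D x y -> (1 < totient #[x])%N.
Proof. by case/dadj_order => x2 _; rewrite totient_gt1. Qed.

Variables (R : realType) (planarD : planar R D).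

Lemma planar_gens (A B : {set gT}) : (2 < #|A|)%N -> (2 < #|B|)%N ->
  ~ (forall x y, x \in A -> y \in B -> adj D x y).
Proof. by move=> A3 B3 /(K33_not_planar A3 B3)/(_ planarD). Qed.

(** Otherwise the generators of the two cyclic groups form a K_{3,3}. *)
Lemma planar_edge x y : adj D x y ->
  (totient #[x] <= 2)%N || (totient #[y] <= 2)%N.
Proof.
move=> xy; apply/negPn/negP; rewrite negb_or -!ltnNge !totient_gen => /andP[xA yB].
apply: (planar_gens xA yB) => x' y'; rewrite !inE => /eqP ex /eqP ey.
exact: dadj_cycle xy.
Qed.

(** The generators of two different cyclic groups number at least four. *)
Lemma planar_path x y y' : adj D x y -> adj D x y' -> <[y]> != <[y']> ->
  (totient #[x] <= 2)%N.
Proof.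
move=> xy xy' yy'; rewrite leqNgt; apply/negP; rewrite totient_gen => xA.
have yB : (2 < #|gens y :|: gens y'|)%N.
  rewrite card_gensU //.
  by move: xy xy'; rewrite ![adj D x _]adj_sym => /dadj_totient + /dadj_totient; lia.
apply: (planar_gens xA yB) => x' z; rewrite !inE => /eqP ex /orP[]/eqP ey.
  exact: dadj_cycle xy.
exact: dadj_cycle xy'.
Qed.

Lemma planar_square x x' y y' : adj D x y -> adj D x y' -> adj D x' y ->
  adj D x' y' -> <[x]> != <[x']> -> <[y]> = <[y']>.
Proof.
move=> xy xy' x'y x'y' xx'; apply/eqP/negPn/negP => yy'.
have xA : (2 < #|gens x :|: gens x'|)%N.
  by rewrite card_gensU //; have := dadj_totient xy; have := dadj_totient x'y; lia.
have yB : (2 < #|gens y :|: gens y'|)%N.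
  rewrite card_gensU //.
  by move: xy xy'; rewrite ![adj D x _]adj_sym => /dadj_totient + /dadj_totient; lia.
apply: (planar_gens xA yB) => u v; rewrite !inE => /orP[]/eqP eu /orP[]/eqP ev;
  [apply: dadj_cycle xy | apply: dadj_cycle xy' | apply: dadj_cycle x'y
  | apply: dadj_cycle x'y']; by rewrite ?eu ?ev.
Qed.

End DifferenceGraph.

(** * The 2-part and the odd part of a nilpotent group *)

Section PrimaryParts.
Local Open Scope group_scope.
Variables (gT : finGroupType).
Implicit Types (x y t z : gT) (p : nat).

Lemma constt_mem_cycle pi x y : x \in <[y]> -> x.`_pi \in <[y.`_pi]>.
Proof. by case/cycleP=> n ->; rewrite consttX mem_cycle. Qed.

(** The factors of [t' * z'] are its constituents, hence powers of it. *)
Lemma mem_cycle_mul pi t t' z z' : pi.-elt t -> pi.-elt t' ->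
  pi^'.-elt z -> pi^'.-elt z' -> commute t z -> commute t' z' ->
  (t * z \in <[t' * z']>) = (t \in <[t']>) && (z \in <[z']>).
Proof.
move=> pt pt' pz pz' tz tz'.
have part (u v : gT) : pi.-elt u -> pi^'.-elt v -> commute u v ->
    (u * v).`_pi = u /\ (u * v).`_pi^' = v.
  move=> pu pv uv; have /constt1P u1 : pi^'^'.-elt u by rewrite p_eltNK.
  by rewrite !consttM // !(constt_p_elt pu, constt_p_elt pv) u1 (constt1P pv) mulg1 mul1g.
have [et ez] := part _ _ pt pz tz; have [et' ez'] := part _ _ pt' pz' tz'.
apply/idP/andP => [tzm|[tm zm]].
  by split; [rewrite -et -et'|rewrite -ez -ez']; exact: constt_mem_cycle.
have /fintype.subsetP st : <[t']> \subset <[t' * z']> by rewrite cycle_subG -{1}et' cycle_constt.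
have /fintype.subsetP sz : <[z']> \subset <[t' * z']> by rewrite cycle_subG -{1}ez' cycle_constt.
by apply: groupM; [exact: st|exact: sz].
Qed.

Lemma prime_order_mem p x y : prime p -> #[x] = p -> #[y] = p ->
  x \in <[y]> -> y \in <[x]>.
Proof.
move=> pp ox oy xy; rewrite -cycle_subG /=.
suff /eqP-> : <[x]> == <[y]> by [].
by rewrite eqEcard cycle_subG xy -!orderE ox oy leqnn.
Qed.

(** A nontrivial element whose order is not [p] has a power of order [p ^ 2]. *)
Lemma order_pow_or_exponent p (H : {group gT}) : prime p -> p.-group H ->
  (exists2 x, x \in H & #[x] = p ^ 2)%N \/
  {in H, forall x, x != 1 -> #[x] = p}.
Proof.
move=> pp pH.
have [/exists_inP[x xH /eqP ox]|nex] := boolP [exists x in H, #[x] == p ^ 2]%N.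
  by left; exists x.
right=> x xH x1; have [k ok] := p_natP (mem_p_elt pH xH).
case: k ok => [|[|k]] ok; first by move: x1; rewrite -order_eq1 ok expn0.
  by rewrite ok expn1.
case/exists_inP: nex; exists (x ^+ (p ^ k)); first exact: groupX.
rewrite orderXdiv ok ?dvdn_exp2l ?leqW //.
by rewrite -expnB ?prime_gt0 ?leqW // -addn2 addKn.
Qed.

End PrimaryParts.

Section Parts.
Local Open Scope group_scope.
Variables (gT : finGroupType) (G : {group gT}).
Hypothesis nilG : nilpotent G.
Notation D := (difference_graph G).
Notation P := (pcore 2%N G).
Notation Q := (pcore (negn 2%N) G).
Implicit Types (t z c x y : gT).

Lemma two_part_elt t : t \in P -> 2%N.-elt t.
Proof. exact: (mem_p_elt (pcore_pgroup _ _)). Qed.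

Lemma odd_part_elt z : z \in Q -> (negn 2%N).-elt z.
Proof. exact: (mem_p_elt (pcore_pgroup _ _)). Qed.

Lemma parts_commute t z : t \in P -> z \in Q -> commute t z.
Proof.
move=> tP zQ; have [_ _ /centsP cPQ _] := dprodP (nilpotent_pcoreC 2%N nilG).
by apply/commute_sym/cPQ.
Qed.

Lemma parts_mem t z : t \in P -> z \in Q -> t * z \in G.
Proof.
move=> /(fintype.subsetP (pcore_sub _ _)) tG /(fintype.subsetP (pcore_sub _ _)) zG.
exact: groupM.
Qed.

Lemma parts_order t z : t \in P -> z \in Q -> #[t * z] = (#[t] * #[z])%N.
Proof.
move=> tP zQ; apply: orderM; first exact: parts_commute.
exact: pnat_coprime (two_part_elt tP) (odd_part_elt zQ).
Qed.

Lemma parts_cycle t t' z z' : t \in P -> t' \in P -> z \in Q -> z' \in Q ->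
  (t * z \in <[t' * z']>) = (t \in <[t']>) && (z \in <[z']>).
Proof.
by move=> tP t'P zQ z'Q; apply: (@mem_cycle_mul _ 2%N); rewrite ?two_part_elt ?odd_part_elt //;
  exact: parts_commute.
Qed.

Lemma parts_cycle_eq t t' z z' : t \in P -> t' \in P -> z \in Q -> z' \in Q ->
  <[t * z]> = <[t' * z']> -> (t' \in <[t]>) && (z' \in <[z]>).
Proof. by move=> tP t'P zQ z'Q e; rewrite -parts_cycle // e cycle_id. Qed.

(** The common element of the two cyclic groups is given by its two parts. *)
Lemma dadj_parts tc zc t t' z z' : tc * zc != 1 ->
  t \in P -> t' \in P -> z \in Q -> z' \in Q ->
  tc \in <[t]> -> tc \in <[t']> -> zc \in <[z]> -> zc \in <[z']> ->
  ~~ ((t \in <[t']>) && (z \in <[z']>)) -> ~~ ((t' \in <[t]>) && (z' \in <[z]>)) ->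
  adj D (t * z) (t' * z').
Proof.
move=> c1 tP t'P zQ z'Q ct ct' cz cz' n1 n2.
have [tcP zcQ] : tc \in P /\ zc \in Q.
  by split; [move: ct|move: cz]; apply: fintype.subsetP; rewrite cycle_subG.
apply: (dadjI (c := tc * zc)); rewrite ?parts_mem ?parts_cycle ?c1 //.
  by rewrite ct cz.
by rewrite ct' cz'.
Qed.

Lemma dadj_common_odd t t' z : t \in P -> t' \in P -> z \in Q -> z != 1 ->
  t \notin <[t']> -> t' \notin <[t]> -> adj D (t * z) (t' * z).
Proof.
move=> tP t'P zQ z1 tt' t't.
by apply: (@dadj_parts 1 z); rewrite ?mul1g ?group1 ?cycle_id ?negb_and ?tt' ?t't.
Qed.

Lemma dadj_common_two t z z' : t \in P -> t != 1 -> z \in Q -> z' \in Q ->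
  z \notin <[z']> -> z' \notin <[z]> -> adj D (t * z) (t * z').
Proof.
move=> tP t1 zQ z'Q zz' z'z.
by apply: (@dadj_parts t 1); rewrite ?mulg1 ?group1 ?cycle_id ?negb_and ?zz' ?z'z ?orbT.
Qed.

(** The common element is [c] itself. *)
Lemma dadj_odd_subcycle z c t : z \in Q -> t \in P -> t != 1 -> c \in <[z]> -> c != 1 ->
  z \notin <[c]> -> adj D z (t * c).
Proof.
move=> zQ tP t1 cz c1 zc.
have cQ : c \in Q by move: cz; apply: fintype.subsetP; rewrite cycle_subG.
have t'1 : t \notin <[1]> by apply: contra t1; rewrite cycle1 => /set1gP->.
rewrite -[z in adj _ z]mul1g; apply: (@dadj_parts 1 c);
  by rewrite ?mul1g ?group1 ?cycle_id ?negb_and ?t'1 ?zc ?orbT.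
Qed.

Lemma dadj_two_subcycle t c z : t \in P -> z \in Q -> z != 1 -> c \in <[t]> -> c != 1 ->
  t \notin <[c]> -> adj D t (c * z).
Proof.
move=> tP zQ z1 ct c1 tc.
have cP : c \in P by move: ct; apply: fintype.subsetP; rewrite cycle_subG.
have z'1 : z \notin <[1]> by apply: contra z1; rewrite cycle1 => /set1gP->.
rewrite -[t in adj _ t]mulg1; apply: (@dadj_parts c 1);
  by rewrite ?mulg1 ?group1 ?cycle_id ?negb_and ?z'1 ?tc ?orbT.
Qed.

End Parts.

(** * Consequences of planarity *)

Section PlanarNilpotent.
Local Open Scope group_scope.
Variables (gT : finGroupType) (G : {group gT}).
Hypothesis nilG : nilpotent G.
Notation D := (difference_graph G).
Notation P := (pcore 2%N G).
Notation Q := (pcore (negn 2%N) G).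
Implicit Types (t z c x y s : gT).
Variables (R : realType) (planarD : planar R D).

Lemma order_4_or_6 x y : adj D x y -> (totient #[x] <= 2)%N -> #[x] \in [:: 4; 6]%N.
Proof.
move=> /dadj_order[x2 npr] /(totient_le2 (order_gt0 x)).
by rewrite !inE => /or4P[/eqP e|/eqP e|/eqP e|//]; move: x2 npr; rewrite e.
Qed.

Lemma edge_order_4_or_6 x y : adj D x y -> (#[x] \in [:: 4; 6]%N) || (#[y] \in [:: 4; 6]%N).
Proof.
move=> xy; have yx : adj D y x by rewrite adj_sym.
by case/orP: (planar_edge planarD xy) => [/(order_4_or_6 xy)->|/(order_4_or_6 yx)->];
  rewrite ?orbT.
Qed.

Lemma path_same_cycle x y y' : adj D x y -> adj D x y' -> #[x] \notin [:: 4; 6]%N ->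
  <[y]> = <[y']>.
Proof.
move=> xy xy' nx; apply/eqP; apply: contraNT nx => yy'.
exact: order_4_or_6 xy (planar_path planarD xy xy' yy').
Qed.

Lemma odd_not_4_or_6 x : odd #[x] -> #[x] \notin [:: 4; 6]%N.
Proof. by rewrite !inE; case: eqP => [->|] //; case: eqP => [->|]. Qed.

Lemma odd_part_odd z : z \in Q -> odd #[z].
Proof. by move/odd_part_elt; rewrite odd_2'nat. Qed.

(** An element of odd order has order neither 4 nor 6. *)
Lemma edge_even x y : adj D x y -> (2 %| #|G|)%N.
Proof.
move=> xy; have : x \in G /\ y \in G by move: xy; rewrite dadjE => /and3P[].
case=> xG yG; rewrite dvdn2; apply/negP => oG.
have o z : z \in G -> #[z] \notin [:: 4; 6]%N.
  by move/order_dvdG/dvdn_odd/(_ oG)/odd_not_4_or_6.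
by have := edge_order_4_or_6 xy; rewrite (negPf (o x xG)) (negPf (o y yG)).
Qed.

(** If [y] were outside [<[x]>], so would be [x * y], and [s * x] would be joined
    to both [s * y] and [s * (x * y)].  These then generate the same group, whence
    [x] is a power of [y] after all. *)
Lemma odd_part_cycle s x : s \in P -> s != 1 -> x \in Q -> #[s * x] \notin [:: 4; 6]%N ->
  {in Q, forall y, x \in <[y]> -> y \in <[x]>} -> Q = <[x]>.
Proof.
move=> sP s1 xQ nsx maxx; apply/eqP; rewrite finset.eqEsubset cycle_subG xQ andbT.
apply/fintype.subsetP => y yQ; apply: contraT => yx.
have nxy : x \notin <[y]> by apply: contra yx; exact: maxx.
have xyQ : x * y \in Q by exact: groupM.
have xyx : x * y \notin <[x]> by rewrite groupMl ?cycle_id.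
have xxy : x \notin <[x * y]> by apply: contra xyx; exact: maxx.
have := path_same_cycle (dadj_common_two nilG sP s1 xQ yQ nxy yx)
  (dadj_common_two nilG sP s1 xQ xyQ xxy xyx) nsx.
case/(parts_cycle_eq nilG sP sP yQ xyQ)/andP=> _ xyy.
by move: nxy; rewrite -(groupMr _ (cycle_id y)) xyy.
Qed.

Lemma two_part_cycle z x : z \in Q -> z != 1 -> x \in P -> #[x * z] \notin [:: 4; 6]%N ->
  {in P, forall y, x \in <[y]> -> y \in <[x]>} -> P = <[x]>.
Proof.
move=> zQ z1 xP nxz maxx; apply/eqP; rewrite finset.eqEsubset cycle_subG xP andbT.
apply/fintype.subsetP => y yP; apply: contraT => yx.
have nxy : x \notin <[y]> by apply: contra yx; exact: maxx.
have xyP : x * y \in P by exact: groupM.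
have xyx : x * y \notin <[x]> by rewrite groupMl ?cycle_id.
have xxy : x \notin <[x * y]> by apply: contra xyx; exact: maxx.
have := path_same_cycle (dadj_common_odd nilG xP yP zQ z1 nxy yx)
  (dadj_common_odd nilG xP xyP zQ z1 xxy xyx) nxz.
case/(parts_cycle_eq nilG yP xyP zQ zQ)/andP=> xyy _.
by move: nxy; rewrite -(groupMr _ (cycle_id y)) xyy.
Qed.

Lemma parts_cyclic t z : P = <[t]> -> Q = <[z]> -> cyclic G /\ #|G| = (#[t] * #[z])%N.
Proof.
move=> eP eQ; have [tP zQ] : t \in P /\ z \in Q by rewrite eP eQ !cycle_id.
have dG := nilpotent_pcoreC 2%N nilG.
split; last by rewrite -(dprod_card dG) /= eP eQ.
rewrite (cyclic_dprod dG) /= ?eP ?eQ ?cycle_cyclic //.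
exact: (pnat_coprime (two_part_elt tP) (odd_part_elt zQ)).
Qed.

Lemma order_neq1 x n : #[x] = n -> (1 < n)%N -> x != 1.
Proof. by move=> ox n1; rewrite -order_eq1 ox gtn_eqF. Qed.

(** For two odd primes [q < r], elements of order [q * r] and [2 * r] sharing the
    subgroup of order [r] would be joined, and neither order is 4 or 6. *)
Lemma odd_part_pgroup s z q : s \in P -> #[s] = 2%N -> z \in Q -> prime q -> #[z] = q ->
  q.-group Q.
Proof.
have key s' z' w q' r : s' \in P -> #[s'] = 2%N -> z' \in Q -> w \in Q ->
    prime q' -> #[z'] = q' -> prime r -> #[w] = r -> (q' < r)%N -> False.
  move=> sP os zQ wQ pq oz pr ow qr.
  have co : coprime #[z'] #[w] by rewrite oz ow prime_coprime // dvdn_prime2 // ltn_eqF.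
  have zw : commute z' w.
    have := @sub_nilpotent_cent2 _ <[w]>%G <[z']>%G G nilG.
    have sQG := fintype.subsetP (pcore_sub (negn 2%N) G).
    rewrite !cycle_subG (sQG _ zQ) (sQG _ wQ).
    by rewrite /= cent_cycle -!orderE co => /(_ isT isT isT) /cent1P /commute_sym.
  have ozw : #[z' * w] = (q' * r)%N by rewrite orderM // oz ow.
  have zwQ : z' * w \in Q by exact: groupM.
  (* The common element: raising [z' * w] to the power [q'] removes [z']. *)
  have c1 : w ^+ q' != 1.
    by rewrite -order_dvdn ow dvdn_prime2 // gtn_eqF.
  have q0 := prime_gt0 pq; have r0 := prime_gt0 pr.
  have r3 : (3 < r)%N.
    have := odd_part_odd zQ; have := odd_part_odd wQ; rewrite oz ow; have := prime_gt1 pq. lia.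
  have : adj D (z' * w) (s' * w).
    rewrite -[z' * w]mul1g.
    apply: (@dadj_parts _ _ nilG 1 (w ^+ q')); rewrite ?mul1g ?group1 ?mem_cycle //.
    - by rewrite -[w ^+ q']mul1g -{1}(expg_order z') oz -expgMn // mem_cycle.
    - apply/negP => /andP[_] /order_dvdG; rewrite -orderE ozw ow.
      by move=> /dvdn_leq -/(_ r0); have := prime_gt1 pq; nia.
    by rewrite cycle1 inE -order_eq1 os.
  move/edge_order_4_or_6; rewrite (negPf (odd_not_4_or_6 (odd_part_odd zwQ))).
  rewrite (parts_order nilG) // os ow !inE.
  lia.
move=> sP os zQ pq oz; apply/pgroupP => r pr /(Cauchy pr)[w wQ ow].
rewrite inE /=; case: (ltngtP r q) => // [rq|qr].
  by case: (key s w z r q).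
by case: (key s z w q r).
Qed.

End PlanarNilpotent.

(** * Nilpotent groups with a planar difference graph *)

Section Cases.
Local Open Scope group_scope.
Variables (gT : finGroupType) (G : {group gT}).
Hypothesis nilG : nilpotent G.
Notation D := (difference_graph G).
Notation P := (pcore 2%N G).
Notation Q := (pcore (negn 2%N) G).
Implicit Types (t z c x y s : gT).
Variables (R : realType) (planarD : planar R D).

(** For each [t != 1] in the 2-part, [x] is joined to [t * x ^+ q].  As [#[x]] is
    odd, the order of the latter is 4 or 6, so [q = 3], and all these elements
    generate the same group, so the 2-part has order 2.  The odd part cannot be
    larger than [<[x]>] because the order 18 of [s * x] is neither 4 nor 6. *)
Lemma order9_odd_part s q x : s \in P -> #[s] = 2%N -> prime q -> x \in Q ->
  #[x] = (q ^ 2)%N -> cyclic G /\ #|G| = 18%N.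
Proof.
move=> sP os pq xQ ox; have q1 := prime_gt1 pq.
have qx : (q %| #[x])%N by rewrite ox expnS dvdn_mulr.
have oc : #[x ^+ q] = q by rewrite orderXdiv // ox expnS mulKn ?expn1 // ltnW.
have c1 : x ^+ q != 1 by exact: order_neq1 oc q1.
have cQ : x ^+ q \in Q by exact: groupX.
have xc : x \notin <[x ^+ q]>.
  apply/negP => /order_dvdG; rewrite -orderE oc ox => /dvdn_leq; have := prime_gt0 pq; nia.
have edge t : t \in P -> t != 1 -> adj D x (t * x ^+ q).
  by move=> tP t1; apply: dadj_odd_subcycle => //; exact: mem_cycle.
have s1 : s != 1 by exact: order_neq1 os isT.
have nx := odd_not_4_or_6 (odd_part_odd xQ).
have q3 : q = 3.
  have := edge_order_4_or_6 planarD (edge s sP s1).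
  rewrite (negPf nx) (parts_order nilG) // os oc !inE.
  by have := odd_part_odd cQ; rewrite oc; lia.
have eP : P = <[s]>.
  apply/eqP; rewrite finset.eqEsubset cycle_subG sP andbT.
  apply/fintype.subsetP => t tP; have [->|t1] := eqVneq t 1; first exact: group1.
  have e := path_same_cycle planarD (edge s sP s1) (edge t tP t1) nx.
  by have /andP[] := parts_cycle_eq nilG sP tP cQ cQ e.
have nsx : #[s * x] \notin [:: 4; 6]%N by rewrite (parts_order nilG) // os ox q3.
suff eQ : Q = <[x]>.
  by have := parts_cyclic nilG eP eQ; rewrite os ox q3.
apply: (odd_part_cycle nilG planarD sP s1 xQ nsx) => y yQ xy; apply: contraT => yx.
have x1 : x != 1 by apply: order_neq1 ox _; rewrite q3.
have := edge_order_4_or_6 planarD (dadj_odd_subcycle nilG yQ sP s1 xy x1 yx).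
by rewrite (negPf nsx) (negPf (odd_not_4_or_6 (odd_part_odd yQ))).
Qed.

Lemma odd_part_cycle_sym q z : {in Q, forall w, w != 1 -> #[w] = q} -> prime q ->
  z \in Q -> z != 1 -> {in Q, forall w, z \in <[w]> -> w \in <[z]>}.
Proof.
move=> expQ pq zQ z1 w wQ zw; apply: (prime_order_mem pq _ _ zw); apply: expQ => //.
by apply: contraNneq z1 => w1; move: zw; rewrite w1 cycle1 => /set1gP->.
Qed.

(** Both parts are filled by cyclic groups because the order [4 * q] of [x * z]
    is neither 4 nor 6. *)
Lemma order4_two_part q x z : x \in P -> #[x] = 4%N -> prime q -> z \in Q -> #[z] = q ->
  {in Q, forall w, w != 1 -> #[w] = q} -> cyclic G /\ #|G| = (4 * q)%N.
Proof.
move=> xP ox pq zQ oz expQ; have q1 := prime_gt1 pq.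
have z1 : z != 1 by exact: order_neq1 oz q1.
have x1 : x != 1 by exact: order_neq1 ox isT.
have q3 : (2 < q)%N by have := odd_part_odd zQ; rewrite oz; lia.
have nxz : #[x * z] \notin [:: 4; 6]%N.
  by rewrite (parts_order nilG) // ox oz !inE; lia.
have eQ : Q = <[z]>.
  by apply: (odd_part_cycle nilG planarD xP x1 zQ nxz); exact: odd_part_cycle_sym expQ pq zQ z1.
suff eP : P = <[x]> by have := parts_cyclic nilG eP eQ; rewrite ox oz.
apply: (two_part_cycle nilG planarD zQ z1 xP nxz) => y yP xy; apply: contraT => yx.
have := edge_order_4_or_6 planarD (dadj_two_subcycle nilG yP zQ z1 xy x1 yx).
rewrite (negPf nxz) orbF !inE => /orP[/eqP oy|/eqP oy].
  case/negP: yx; suff /eqP-> : <[x]> == <[y]> by exact: cycle_id.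
  by rewrite eqEcard cycle_subG xy -!orderE ox oy.
have := two_part_elt yP; rewrite /p_elt oy => /p_natP[k].
by case: k => [|[|[|k]]] //; rewrite !expnS; lia.
Qed.

(** Outside [<[z]>] there would be an element [y], and [z], [y] would be joined,
    after multiplication by the involution [s], to both [z * y] and [z * y^-1].
    Planarity makes the last two generate the same group; it contains [y ^+ 2],
    hence [y], and then [z]. *)
Lemma odd_part_prime q s z : s \in P -> #[s] = 2%N -> prime q -> z \in Q -> #[z] = q ->
  {in Q, forall w, w != 1 -> #[w] = q} -> Q = <[z]>.
Proof.
move=> sP os pq zQ oz expQ; have q1 := prime_gt1 pq.
have z1 : z != 1 by exact: order_neq1 oz q1.
have s1 : s != 1 by exact: order_neq1 os isT.
have sym := odd_part_cycle_sym expQ pq.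
apply/eqP; rewrite finset.eqEsubset cycle_subG zQ andbT.
apply/fintype.subsetP => y yQ; apply: contraT => yz.
have y1 : y != 1 by apply: contraNneq yz => ->.
have zy : z \notin <[y]> by apply: contra yz; exact: sym.
have edge u v : u \in Q -> v \in Q -> u \notin <[v]> -> v != 1 -> adj D (s * u) (s * v).
  move=> uQ vQ uv v1; apply: dadj_common_two => //.
  by apply: contra uv; apply: sym.
have prodz v : v \in Q -> v \notin <[z]> -> z \notin <[v]> ->
    [/\ z * v \in Q, z * v != 1, z \notin <[z * v]> & v \notin <[z * v]> ].
  move=> vQ vz zv.
  have zvz : z * v \notin <[z]> by rewrite groupMl ?cycle_id.
  have zvv : z * v \notin <[v]> by rewrite groupMr ?cycle_id.
  have v1 : v != 1 by apply: contraNneq vz => ->.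
  have zvQ : z * v \in Q by exact: groupM.
  split=> //.
  - by apply: contraNneq zvz => ->; exact: group1.
  - by apply: contra zvz; apply: sym.
  by apply: contra zvv; apply: sym.
have [aQ a1 za ya] := prodz y yQ yz zy.
have [bQ b1 zb yb] : [/\ z * y^-1 \in Q, z * y^-1 != 1, z \notin <[z * y^-1]>
    & y^-1 \notin <[z * y^-1]> ] by apply: prodz; rewrite ?groupV // cycleV.
rewrite groupV in yb.
have nsz : <[s * z]> != <[s * y]>.
  apply/eqP => /esym/(parts_cycle_eq nilG sP sP yQ zQ).
  by rewrite (negPf zy) andbF.
have e := planar_square planarD (edge _ _ zQ aQ za a1) (edge _ _ zQ bQ zb b1)
  (edge _ _ yQ aQ ya a1) (edge _ _ yQ bQ yb b1) nsz.
have ba : z * y^-1 \in <[z * y]>.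
  by have /andP[] := parts_cycle_eq nilG sP sP aQ bQ e.
have y2 : y ^+ 2 \in <[z * y]>.
  have -> : y ^+ 2 = (z * y^-1)^-1 * (z * y).
    by rewrite invMg invgK -mulgA mulKg expgS expg1.
  by rewrite groupM ?groupV ?cycle_id.
(* Squaring is invertible on a cyclic group of odd order [q]. *)
case/negP: ya; have e2 : y = (y ^+ 2) ^+ (q.+1 %/ 2).
  rewrite -expgM mulnC divnK; last first.
    by rewrite dvdn2 /=; have := odd_part_odd zQ; rewrite oz => ->.
  by rewrite expgS -(expQ y yQ y1) expg_order mulg1.
by rewrite [X in X \in _]e2 groupX.
Qed.

(** Two involutions already force [q = 3] through an edge between elements of
    order [2 * q].  A further involution [r] outside the four-group of [s] and [t]
    would give a 4-cycle through the classes of [s], [r], [t] and [r * s]. *)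
Lemma two_part_klein s z q : s \in P -> #[s] = 2%N -> prime q -> z \in Q -> #[z] = q ->
  {in P, forall t, t != 1 -> #[t] = 2%N} -> P <> <[s]> -> #|P| = 4%N /\ q = 3.
Proof.
move=> sP os pq zQ oz expP nP; have q1 := prime_gt1 pq.
have z1 : z != 1 by exact: order_neq1 oz q1.
have s1 : s != 1 by exact: order_neq1 os isT.
have mem2 a b : a \in P -> b \in P -> a \in <[b]> -> a = 1 \/ a = b.
  move=> aP bP; have [->|b1] := eqVneq b 1.
    by rewrite cycle1 => /set1gP; left.
  by rewrite (cycle2g (expP b bP b1)) !inE => /orP[]/eqP; [left|right].
have edge a b : a \in P -> b \in P -> a != 1 -> b != 1 -> a != b ->
    adj D (a * z) (b * z).
  move=> aP bP a1 b1 ab; apply: dadj_common_odd => //; apply/negP.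
    by case/(mem2 _ _ aP bP) => e; [rewrite e eqxx in a1|rewrite e eqxx in ab].
  by case/(mem2 _ _ bP aP) => e; [rewrite e eqxx in b1|rewrite e eqxx in ab].
have [t tP ts] : exists2 t, t \in P & t \notin <[s]>.
  apply/fintype.subsetPn; apply/negP => sub; apply: nP; apply/eqP.
  by rewrite finset.eqEsubset sub cycle_subG.
have t1 : t != 1 by apply: contraNneq ts => ->.
have t_s : t != s by apply: contraNneq ts => ->; exact: cycle_id.
have q3 : q = 3.
  have := edge_order_4_or_6 planarD (edge _ _ tP sP t1 s1 t_s).
  rewrite !(parts_order nilG) // os oz (expP t) // orbb !inE.
  by have := odd_part_odd zQ; rewrite oz; lia.
split => //.
have tsP : t * s \in P by exact: groupM.
have tsV : t * s != 1.
  apply/eqP => e; case/negP: ts; have -> : t = s^-1 by apply/eqP; rewrite eq_mulgV1 invgK e.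
  by rewrite groupV cycle_id.
have nts : <[s * z]> != <[t * z]>.
  by apply/eqP => /(parts_cycle_eq nilG sP tP zQ zQ); rewrite (negPf ts).
have eP : P = [set 1; s; t; t * s].
  apply/setP => r; rewrite !inE; apply/idP/idP => [rP|]; last first.
    by case/orP => [/orP[/orP[]|]|] /eqP-> //; exact: group1.
  apply: contraT; rewrite !negb_or => /andP[/andP[/andP[r1 rs] rt] rts].
  have rsP : r * s \in P by exact: groupM.
  have s2 : s * s = 1 by rewrite -(expg_order s) os expgS expg1.
  have rs1 : r * s != 1 by apply: contraNneq rs => e; rewrite -[r]mulg1 -s2 mulgA e mul1g.
  have rss : r * s != s by apply: contraNneq r1 => e; rewrite -[r]mulg1 -s2 mulgA e s2.
  have rst : r * s != t by apply: contraNneq rts => <-; rewrite -mulgA s2 mulg1.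
  have ne (u v : gT) : u != v -> v != u by rewrite eq_sym.
  have e := planar_square planarD
    (edge _ _ sP rP s1 r1 (ne _ _ rs)) (edge _ _ sP rsP s1 rs1 (ne _ _ rss))
    (edge _ _ tP rP t1 r1 (ne _ _ rt)) (edge _ _ tP rsP t1 rs1 (ne _ _ rst)) nts.
  have /andP[+ _] := parts_cycle_eq nilG rP rsP zQ zQ e.
  case/(mem2 _ _ rsP rP) => e'; first by rewrite e' eqxx in rs1.
  by case/eqP: s1; apply: (mulgI r); rewrite e' mulg1.
rewrite eP; have -> : [set 1; s; t; t * s] = [set u in [:: 1; s; t; t * s]].
  by apply/setP => u; rewrite !inE !orbA.
rewrite cardsE; apply/card_uniqP.
rewrite /= !inE !negb_or ![1 == _]eq_sym s1 t1 tsV [s == t]eq_sym t_s.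
rewrite [s == t * s]eq_sym -(inj_eq (mulIg s^-1)) mulgK mulgV t1.
by rewrite -[t == t * s](inj_eq (mulgI t^-1)) mulVg mulKg eq_sym s1.
Qed.

(** The ends of an edge would both have order [2 * q] and generate the group. *)
Lemma cyclic_2q_no_edge s z q : P = <[s]> -> #[s] = 2%N -> prime q -> Q = <[z]> -> #[z] = q ->
  forall x y, ~ adj D x y.
Proof.
move=> eP os pq eQ oz x y xy; have [_] := parts_cyclic nilG eP eQ; rewrite os oz => oG.
have [x2 npr] := dadj_order xy; move: xy; rewrite dadjE => /and5P[xG yG _ _ /negP[]].
have := order_dvdG xG; rewrite oG mulnC => d.
suff /eqP-> : <[x]> == G by [].
rewrite eqEcard cycle_subG xG -orderE oG mulnC.
have [/dvdnP[k ek]|nqx] := boolP (q %| #[x])%N; last first.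
  move: d; rewrite Gauss_dvdr; last by rewrite coprime_sym prime_coprime.
  by move/dvdn_leq => /(_ isT); lia.
move: d npr; rewrite ek mulnC dvdn_pmul2l ?prime_gt0 // => /dvdn_leq -/(_ isT).
case: k ek => [|[|[|k]]] ek // _; first by move: x2; rewrite ek.
  by rewrite muln1 pq.
by rewrite leqnn.
Qed.

Lemma planar_nilpotent_groups : ~~ 2%N.-group G -> (exists x y, adj D x y) ->
  [\/ exists P' Q' : {group gT},
        [/\ P' \x Q' = G, 2%N.-abelem P', #|P'| = 4%N & #|Q'| = 3%N],
      cyclic G /\ #|G| = 18%N
    | exists p, [/\ prime p, p <> 2%N & cyclic G /\ #|G| = (4 * p)%N]].
Proof.
move=> not2G [x [y xy]]; have dG := nilpotent_pcoreC 2%N nilG.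
have cG := dprod_card dG.
have oddQ : odd #|Q| by rewrite odd_2'nat; exact: pcore_pgroup.
have [s sP os] : {s | s \in P & #[s] = 2%N}.
  apply: Cauchy => //; have := edge_even planarD xy; rewrite -cG Euclid_dvdM //.
  by case/orP => //; rewrite dvdn2 oddQ.
have Q1 : #|Q| != 1%N.
  apply: contra not2G => /eqP Q1; rewrite /pgroup -cG Q1 muln1; exact: pcore_pgroup.
have Q0 := cardG_gt0 (pcore_group (negn 2%N) G).
have pq : prime (pdiv #|Q|) by apply: pdiv_prime; move: Q1 Q0; rewrite /=; lia.
have [z zQ oz] := Cauchy pq (pdiv_dvd #|Q|).
move: (pdiv _) pq oz => q pq oz.
have qQ : q.-group Q := odd_part_pgroup nilG planarD sP os zQ pq oz.
have q2 : q <> 2%N by move=> q2; have := odd_part_odd zQ; rewrite oz q2.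
case: (order_pow_or_exponent pq qQ) => [[w wQ ow]|expQ].
  by constructor 2; exact: order9_odd_part sP os pq wQ ow.
have prime2 : prime 2 by [].
case: (order_pow_or_exponent prime2 (pcore_pgroup 2%N G)) => [[w wP ow]|expP].
  by constructor 3; exists q; split => //; exact: order4_two_part wP ow pq zQ oz expQ.
have eQ := odd_part_prime sP os pq zQ oz expQ.
have [eP|/eqP nP] := eqVneq P <[s]>.
  by case: (cyclic_2q_no_edge eP os pq eQ oz xy).
have [P4 q3] := two_part_klein sP os pq zQ oz expP nP.
constructor 1; exists (pcore_group 2%N G), (pcore_group (negn 2%N) G); split=> //.
  apply/abelemP => //; split; first exact: (card_p2group_abelian prime2 P4).
  move=> t tP; have [->|t1] := eqVneq t 1; first exact: expg1n.
  by rewrite -(expP t tP t1) expg_order.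
by rewrite /= eQ -orderE oz q3.
Qed.

End Cases.

(** * Recognition of the groups in the list *)

Section ZmodGroups.
Local Open Scope group_scope.

Lemma set_prodT (A B : finGroupType) :
  finset.setX [set: A]%G 1%G \x finset.setX 1%G [set: B]%G = [set: A * B].
Proof. by rewrite setX_dprod; apply/setP => -[a b]; rewrite !inE. Qed.

Lemma card_Zn m : (1 < m)%N -> #|[set: 'Z_m]| = m.
Proof. by move=> m1; rewrite cardsT card_ord Zp_cast. Qed.

Lemma cyclic_Zn m : cyclic [set: 'Z_m].
Proof. by rewrite Zp_cycle cycle_cyclic. Qed.

Lemma isog_ZmZn (gT : finGroupType) (G : {group gT}) m n :
  (1 < m)%N -> (1 < n)%N -> coprime m n ->
  (G \isog [set: 'Z_m * 'Z_n]) = cyclic G && (#|G| == (m * n)%N).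
Proof.
move=> m1 n1 co.
have cZ : cyclic [set: 'Z_m * 'Z_n].
  rewrite (cyclic_dprod (set_prodT _ _)) /=;
    rewrite -?(isog_cyclic (isog_setX1 _ _)) -?(isog_cyclic (isog_set1X _ _)) ?cyclic_Zn //.
  by rewrite -(card_isog (isog_setX1 _ _)) -(card_isog (isog_set1X _ _)) !card_Zn.
have oZ : #|[set: 'Z_m * 'Z_n]| = (m * n)%N by rewrite cardsT card_prod -!cardsT !card_Zn.
apply/idP/andP => [iso|[cG /eqP oG]].
  by rewrite (isog_cyclic iso) (card_isog iso) oZ.
by rewrite isog_cyclic_card // cZ oZ oG /=.
Qed.

Lemma abelem_Z2Z2 : 2%N.-abelem [set: 'Z_2 * 'Z_2].
Proof.
apply/abelemP => //; split.
  by apply/centsP => -[a b] _ [c d] _; congr (_, _); exact: FinRing.zmod_mulgC.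
by move=> -[a b] _; apply/eqP; move: a b; do 2!case => [[|[|//]] ?].
Qed.

Lemma isog_Z2Z2Z3 (gT : finGroupType) (G P Q : {group gT}) :
  P \x Q = G -> 2%N.-abelem P -> #|P| = 4%N -> #|Q| = 3%N ->
  G \isog [set: 'Z_2 * 'Z_2 * 'Z_3].
Proof.
move=> dG aP oP oQ; apply: (isog_dprod dG (set_prodT _ _)).
  apply: isog_trans (isog_setX1 _ _); rewrite (isog_abelem_card _ aP) abelem_Z2Z2.
  by rewrite cardsT !card_prod !card_ord oP.
apply: isog_trans (isog_set1X _ _); rewrite isog_cyclic_card ?cyclic_Zn ?card_Zn ?oQ //.
by rewrite prime_cyclic ?oQ.
Qed.

End ZmodGroups.

(** * Groups with a planar difference graph *)

Section Sufficiency.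
Local Open Scope group_scope.
Variables (R : realType) (gT : finGroupType) (G : {group gT}).
Notation D := (difference_graph G).
Implicit Types x y : gT.

Lemma verts_edge x : x \in verts D -> exists y, adj D x y.
Proof. by rewrite inE => /andP[_ /existsP]. Qed.

(** The divisors are separated by whether they are multiples of [q]; those on the
    same side form a chain. *)
Lemma dvdn_p2q p q m : prime p -> prime q -> (m %| p ^ 2 * q)%N ->
  exists2 a, (a <= 2)%N & m = if (q %| m)%N then (p ^ a * q)%N else (p ^ a)%N.
Proof.
move=> pp pq; have [/dvdnP[k ->]|nq] := boolP (q %| m)%N.
  rewrite dvdn_pmul2r ?prime_gt0 // => /(dvdn_pfactor _ _ pp)[a a2 ->].
  by exists a.
rewrite Gauss_dvdl; last by rewrite coprime_sym prime_coprime.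
by case/(dvdn_pfactor _ _ pp) => a a2 ->; exists a.
Qed.

(** Adjacency in a cyclic group says that the orders are neither coprime nor
    comparable for divisibility, which leaves a single pair of divisors. *)
Lemma cyclic_edge p q x y : cyclic G -> prime p -> prime q -> #|G| = (p ^ 2 * q)%N ->
  adj D x y ->
  (#[x] = p ^ 2 /\ #[y] = p * q \/ #[x] = p * q /\ #[y] = p ^ 2)%N.
Proof.
move=> cG pp pq oG; rewrite dadjE => /and5P[xG yG I1 xy yx].
have [sx sy] : <[x]> \subset G /\ <[y]> \subset G by rewrite !cycle_subG.
have {}I1 : ~~ coprime #[x] #[y] by apply: contra I1 => /coprime_TIg->.
have {}xy : ~~ (#[x] %| #[y])%N by rewrite !orderE (cardSg_cyclic cG) // cycle_subG.
have {}yx : ~~ (#[y] %| #[x])%N by rewrite !orderE (cardSg_cyclic cG) // cycle_subG.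
have := order_dvdG xG; have := order_dvdG yG; rewrite oG.
have key m l : (m %| p ^ 2 * q)%N -> (l %| p ^ 2 * q)%N -> ~~ coprime m l ->
    ~~ (m %| l)%N -> ~~ (l %| m)%N -> (q %| m)%N -> m = (p * q)%N /\ l = (p ^ 2)%N.
  move=> /(dvdn_p2q pp pq)[a a2 em] /(dvdn_p2q pp pq)[b b2 el] nc ml lm qm.
  rewrite qm in em; move: el; case: ifP => ql el.
    have := leq_total a b; rewrite {}em {}el in ml lm *.
    case/orP => ab; [move: ml|move: lm]; by rewrite dvdn_pmul2r ?prime_gt0 // dvdn_exp2l.
  have ab : (a < b)%N.
    by rewrite ltnNge; apply: contra lm => ba; rewrite em el dvdn_mulr ?dvdn_exp2l.
  have a0 : (0 < a)%N.
    case: a em {a2} ab => // em b0; case/negP: nc; rewrite em el expn0 mul1n.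
    rewrite coprimeXr // prime_coprime //; apply: contraFN ql => qp.
    by rewrite el dvdn_exp.
  have [a1 b1] : a = 1%N /\ b = 2%N by move: a0 ab b2; clear; lia.
  by rewrite em el a1 b1 expn1.
move=> dy dx; have [qx|nqx] := boolP (q %| #[x])%N; first by right; exact: key.
have [qy|nqy] := boolP (q %| #[y])%N.
  by left; have [] := key _ _ dy dx; rewrite 1?coprime_sym.
have [a a2] := dvdn_p2q pp pq dx; have [b b2] := dvdn_p2q pp pq dy.
rewrite (negPf nqx) (negPf nqy) => el em; rewrite em el in xy yx.
by case/orP: (leq_total a b) => ab; [move: xy|move: yx]; rewrite dvdn_exp2l.
Qed.

(** All elements of one order generate the same subgroup. *)
Lemma cyclic_card_order h : cyclic G -> (#|[set x in G | #[x] == h]| <= totient h)%N.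
Proof.
move=> cG; have [->|[x]] := set_0Vmem [set x in G | #[x] == h]; first by rewrite cards0.
rewrite inE => /andP[xG /eqP<-]; rewrite totient_gen; apply/subset_leq_card/fintype.subsetP => y.
rewrite !inE /generator => /andP[yG /eqP oy].
by rewrite (eq_subG_cyclic cG) ?cycle_subG // -!orderE oy.
Qed.

Lemma cyclic_planar p q h : cyclic G -> prime p -> prime q -> p != q ->
  #|G| = (p ^ 2 * q)%N -> h \in [:: p ^ 2; p * q]%N -> (totient h <= 2)%N -> planar R D.
Proof.
move=> cG pp pq npq oG hh h2; apply: (@two_hubs_planar R _ _ [set x in G | #[x] == h]).
  exact: leq_trans (cyclic_card_order h cG) h2.
move=> x y xy; have := cyclic_edge cG pp pq oG xy.
move: xy; rewrite dadjE !inE => /and3P[-> -> _].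
have ne : (p ^ 2 == p * q)%N = false.
  by rewrite expnS expn1 eqn_pmul2l ?prime_gt0 // (negPf npq).
have ne' : (p * q == p ^ 2)%N = false by rewrite eq_sym.
by move: hh; rewrite !inE => /orP[]/eqP-> [] [-> ->]; rewrite /= eqxx ?ne ?ne'.
Qed.

(** Both coordinates of an end of an edge are nontrivial, as its order is 6.
    Coordinates in the four-group give the class of the octahedron; two elements
    in one class are equal or inverse to each other, hence not joined. *)
Lemma Z2Z2Z3_planar : G \isog [set: 'Z_2 * 'Z_2 * 'Z_3] -> planar R D.
Proof.
pose code (u : 'Z_2 * 'Z_2 * 'Z_3) := (2 * u.1.1 + u.1.2).-1%N.
have coord_inj (u v : 'Z_2 * 'Z_2 * 'Z_3) : u.1 != 1 -> u.2 != 1 ->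
    v.1 != 1 -> v.2 != 1 -> code u = code v ->
    (u.2 == inZp 1) = (v.2 == inZp 1) -> u = v.
  move=> u1 u2 v1 v2 e1 e2; apply/eqP; move: u v u1 u2 v1 v2 e1 e2.
  by do 2!case=> [[[[|[|//]] ?] [[|[|//]] ?]] [[|[|[|//]]] ?]] //.
have coord_inv (u v : 'Z_2 * 'Z_2 * 'Z_3) : u.1 != 1 -> u.2 != 1 ->
    v.1 != 1 -> v.2 != 1 -> code u = code v ->
    (u.2 == inZp 1) != (v.2 == inZp 1) -> u = v^-1.
  move=> u1 u2 v1 v2 e1 e2; apply/eqP; move: u v u1 u2 v1 v2 e1 e2.
  by do 2!case=> [[[[|[|//]] ?] [[|[|//]] ?]] [[|[|[|//]]] ?]] //.
case/isogP => f injf fG.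
have ord x : x \in G -> #[f x] = #[x] by move=> xG; rewrite order_injm.
have nontriv x y : adj D x y -> [/\ x \in G, (f x).1 != 1 & (f x).2 != 1].
  move=> xy; have [x2 npr] := dadj_order xy.
  have xG : x \in G by move: xy; rewrite dadjE => /andP[].
  have no n : prime n -> f x ^+ n != 1.
    move=> pn; apply/eqP => fn; have : (#[x] %| n)%N by rewrite -ord // order_dvdn fn.
    case/primeP: (pn) => _ h /h/orP[]/eqP e; [by move: x2; rewrite e|].
    by move: npr; rewrite e pn.
  split=> //; [have := no 3 isT|have := no 2 isT]; apply: contraNneq => f1.
    rewrite [f x]surjective_pairing f1; case: (f x).2 => [[|[|[|//]]] ?]; by [].
  rewrite [f x]surjective_pairing f1; case: (f x).1 => [[[|[|//]] ?] [[|[|//]] ?]]; by [].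
apply: (@octahedron_planar R _ _ (code \o f) (fun x => (f x).2 == inZp 1)).
- move=> x /verts_edge[y /nontriv[_ + _]]; rewrite /code /=.
  by case: (f x) => [[[[|[|//]] ?] [[|[|//]] ?]] ?].
- move=> x y /verts_edge[x' /nontriv[xG x1 x2]] /verts_edge[y' /nontriv[yG y1 y2]].
  by move=> exy sxy; apply: (injmP injf) => //; apply: coord_inj.
move=> x y xy; apply/eqP => exy.
have [xG x1 x2] := nontriv _ _ xy; have yx : adj D y x by rewrite adj_sym.
have [_ y1 y2] := nontriv _ _ yx.
move: xy; rewrite dadjE => /and5P[_ yG _ /negP nxy _]; apply: nxy.
have [sxy|sxy] := eqVneq ((f x).2 == inZp 1) ((f y).2 == inZp 1).
  suff -> : x = y by exact: cycle_id.
  by apply: (injmP injf) => //; exact: coord_inj.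
suff -> : x = y^-1 by rewrite groupV cycle_id.
by apply: (injmP injf); rewrite ?groupV // morphV //; exact: coord_inv.
Qed.

End Sufficiency.

(** * The classification *)

Theorem theorem2p2 (R : realType) (gT : finGroupType) (G : {group gT})
    (nilG : nilpotent G) (not2G : ~~ (2.-group G)%g)
    (nonnull : verts (difference_graph G) <> finset.set0) :
  planar R (difference_graph G) <->
  [\/ G \isog [set: 'Z_2 * 'Z_2 * 'Z_3]%SET,
      G \isog [set: 'Z_9 * 'Z_2]%SET
    | exists p2 : nat, [/\ prime p2, p2 <> 2 & G \isog [set: 'Z_4 * 'Z_p2]%SET]].
Proof.
have co4 p : prime p -> p <> 2 -> coprime 4 p.
  move=> pp /eqP p2; rewrite (@coprimeXl 2 2) // prime_coprime //.
  by rewrite dvdn_prime2 // eq_sym.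
split=> [planarD|[iso||[p [pp p2]]]].
- have /eqP/finset.set0Pn[x /verts_edge[y xy]] := nonnull.
  have edge : exists x y, adj (difference_graph G) x y by exists x, y.
  have [[P [Q [dG aP oP oQ]]]|[cG oG]|[p [pp p2 [cG oG]]]] :=
    planar_nilpotent_groups nilG planarD not2G edge.
  + by constructor 1; exact: isog_Z2Z2Z3 dG aP oP oQ.
  + by constructor 2; rewrite isog_ZmZn // cG oG.
  constructor 3; exists p; split=> //.
  by rewrite isog_ZmZn ?(prime_gt1 pp) ?co4 // cG oG eqxx.
- exact: Z2Z2Z3_planar.
- rewrite isog_ZmZn // => /andP[cG /eqP oG].
  by apply: (@cyclic_planar _ _ _ 3 2 6).
rewrite isog_ZmZn ?(prime_gt1 pp) ?co4 // => /andP[cG /eqP oG].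
by apply: (@cyclic_planar _ _ _ 2 p 4) => //; rewrite eq_sym; apply/eqP.
Qed.
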